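(* Let $A\in\mathbb{R}^{n\times n}$ be a non-singular matrix diagonalizable over $\mathbb{C}$ whose spectrum satisfies: (P1) every eigenvalue of $A$ is an algebraic integer; (P2) every complex $\mu$ with $|\mu|>1$ algebraically conjugate to an eigenvalue of $A$ is an eigenvalue of $A$, and $m_A(\mu)\geq m_A(\nu)$ for all algebraic conjugates $\nu$ of $\mu$, with strict inequality for at least one such $\nu$. Let $\mu_{A,\mathbb{Q}}=f_1\cdots f_k$ be the factorization of the minimal polynomial of $A$ over $\mathbb{Q}$ into distinct monic polynomials $f_i\in\mathbb{Z}[X]$ irreducible over $\mathbb{Q}$, let $d_i=\deg f_i$ and $M_i:=\max\{m_A(\lambda):\lambda\text{ a root of }f_i\}$. Define $s_i=M_id_i$ if $f_i$ is not a cyclotomic polynomial; if $f_i$ is a cyclotomic polynomial, define $s_i=M_id_i$ if $M_i>\min\{m_A(\lambda):\lambda\text{ a root of }f_i\}$ and $s_i=(M_i+1)d_i$ otherwise. Then $s=s_1+\cdots+s_k$ is the minimal dimension of a lattice $\mathcal{L}\subset\mathbb{R}^s$ for which there exist a generic cut-and-project scheme $\Lambda=(\mathcal{L}\subset\mathbb{R}^s,\mathbb{R}^n)$ and a cut-and-project set $\Sigma(\Omega)$ with $A\Sigma(\Omega)\subset\Sigma(\Omega)$.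
   Context: $m_T(\lambda)$ denotes the algebraic multiplicity of $\lambda$ as an eigenvalue of $T$ ($0$ if not an eigenvalue). The minimal polynomial $\mu_{A,\mathbb{Q}}$ of $A$ over $\mathbb{Q}$ is the monic polynomial in $\mathbb{Q}[X]$ of smallest degree annihilating $A$. A lattice $\mathcal{L}\subset\mathbb{R}^s$ is $\{L\mathbf{r}:\mathbf{r}\in\mathbb{Z}^s\}$ for a non-singular $L\in\mathbb{R}^{s\times s}$. For $1\le n<s$, the cut-and-project scheme $\Lambda=(\mathcal{L}\subset\mathbb{R}^s,\mathbb{R}^n)$ consists of $\mathcal{L}$ with projections $\pi_\parallel(\mathbf{x})=(x_1,\dots,x_n)^\top$, $\pi_\perp(\mathbf{x})=(x_{n+1},\dots,x_s)^\top$; it is generic if $\pi_\parallel|_{\mathcal{L}}$ and $\pi_\perp|_{\mathcal{L}}$ are injective and $\pi_\perp(\mathcal{L})$ is dense in $\mathbb{R}^{s-n}$. For a bounded $\Omega\subset\mathbb{R}^{s-n}$ with $\overline{\Omega^\circ}=\overline{\Omega}\neq\emptyset$, the cut-and-project set is $\Sigma(\Omega)=\{\pi_\parallel(\mathbf{l}):\mathbf{l}\in\mathcal{L},\ \pi_\perp(\mathbf{l})\in\Omega\}$. *)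

(* Defs.v *)
From HB Require Import structures.
From mathcomp Require Import all_boot all_order all_algebra all_field.
From mathcomp Require Import complex.
From mathcomp Require Import boolp classical_sets reals topology normedtype.
From mathcomp Require Import matrix_topology matrix_normedtype.
Import numFieldNormedType.Exports.
Set Implicit Arguments.
Unset Strict Implicit.
Unset Printing Implicit Defensive.
Import Order.TTheory GRing.Theory Num.Theory.
Local Open Scope ring_scope.
Local Open Scope classical_set_scope.

Section CutProject.
Variable R : realType.
Local Notation C := R[i].

Definition Cmx (n : nat) (A : 'M[R]_n) : 'M[C]_n := map_mx (fun x : R => x%:C%C) A.

Definition eigenC (n : nat) (A : 'M[R]_n) (l : C) : bool := eigenvalue (Cmx A) l.

(* algebraic multiplicity m_A(lambda): multiplicity of lambda as a root of
   the characteristic polynomial (0 if lambda is not an eigenvalue) *)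
Definition mA (n : nat) (A : 'M[R]_n) (l : C) : nat := mup l (char_poly (Cmx A)).

Definition alg_integer (z : C) : Prop :=
  exists p : {poly int}, p \is monic /\ root (map_poly intr p) z.

Definition alg_conj (z w : C) : Prop :=
  exists p : {poly rat}, irreducible_poly p /\
    root (map_poly ratr p) z /\ root (map_poly ratr p) w.

Definition P1 (n : nat) (A : 'M[R]_n) : Prop :=
  forall l : C, eigenC A l -> alg_integer l.

Definition P2 (n : nat) (A : 'M[R]_n) : Prop :=
  forall mu : C, 1 < `|mu| -> (exists l, eigenC A l /\ alg_conj mu l) ->
    [/\ eigenC A mu,
        (forall nu, alg_conj mu nu -> (mA A nu <= mA A mu)%N) &
        exists nu, alg_conj mu nu /\ (mA A nu < mA A mu)%N].

Definition is_minpolyQ (n : nat) (A : 'M[R]_n.+1) (p : {poly rat}) : Prop :=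
  [/\ p \is monic, horner_mx A (map_poly ratr p) = 0 &
      forall q : {poly rat}, q \is monic -> horner_mx A (map_poly ratr q) = 0 ->
        (size p <= size q)%N].

Definition is_factorization (p : {poly rat}) (fs : seq {poly rat}) : Prop :=
  [/\ uniq fs, all (fun f => f \is monic) fs,
      (forall f, f \in fs -> irreducible_poly f) &
      \prod_(f <- fs) f = p].

Definition is_cyclotomic (f : {poly rat}) : Prop :=
  exists k : nat, (0 < k)%N /\ f = map_poly intr 'Phi_k.

(* M_f = max { m_A(lambda) : lambda root of f } ; m_A(lambda) <= n.+1 *)
Definition Mmax (n : nat) (A : 'M[R]_n.+1) (f : {poly rat}) : nat :=
  \max_(k < n.+2 | `[< exists l : C, root (map_poly ratr f) l /\ mA A l = k >]) k.

Definition Mmin (n : nat) (A : 'M[R]_n.+1) (f : {poly rat}) : nat :=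
  \big[minn/n.+1]_(k < n.+2 | `[< exists l : C, root (map_poly ratr f) l /\ mA A l = k >]) k.

Definition s_of (n : nat) (A : 'M[R]_n.+1) (f : {poly rat}) : nat :=
  let d := (size f).-1 in
  if `[< is_cyclotomic f >] && ~~ (Mmin A f < Mmax A f)%N
  then ((Mmax A f).+1 * d)%N
  else (Mmax A f * d)%N.

Definition ppar (n m : nat) (x : 'cV[R]_(n + m)) : 'cV[R]_n := usubmx x.
Definition pperp (n m : nat) (x : 'cV[R]_(n + m)) : 'cV[R]_m := dsubmx x.
Arguments ppar {n m} x.
Arguments pperp {n m} x.

Definition lattice (s : nat) (L : 'M[R]_s) : set 'cV[R]_s :=
  [set L *m map_mx intr r | r in [set: 'cV[int]_s]].

Definition generic_cps (n m : nat) (L : 'M[R]_(n + m)) : Prop :=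
  [/\ L \in unitmx,
      (forall x y, lattice L x -> lattice L y -> ppar x = ppar y -> x = y),
      (forall x y, lattice L x -> lattice L y -> pperp x = pperp y -> x = y) &
      dense (pperp @` lattice L)].

Definition window (m : nat) (Om : set 'cV[R]_m) : Prop :=
  [/\ bounded_set Om, closure (interior Om) = closure Om & closure Om !=set0].

Definition cp_set (n m : nat) (L : 'M[R]_(n + m)) (Om : set 'cV[R]_m)
  : set 'cV[R]_n :=
  [set ppar l | l in [set l | lattice L l /\ Om (pperp l)]].

Definition admits_cps (n : nat) (A : 'M[R]_n) (s : nat) : Prop :=
  exists m : nat, [/\ (0 < m)%N, s = (n + m)%N &
    exists L : 'M[R]_(n + m), generic_cps L /\
      exists Om : set 'cV[R]_m, window Om /\
        (forall x, cp_set L Om x -> cp_set L Om (A *m x))].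

End CutProject.

(* Main.v *)
Require Import Defs.
From HB Require Import structures.
From mathcomp Require Import all_boot all_order all_algebra all_field.
From mathcomp Require Import perm complex zify ring lra.
From mathcomp Require Import boolp classical_sets functions cardinality reals ereal.
From mathcomp Require Import topology normedtype realfun measure lebesgue_measure.
From mathcomp Require Import matrix_topology matrix_normedtype.
Import numFieldNormedType.Exports.
Set Implicit Arguments.
Unset Strict Implicit.
Unset Printing Implicit Defensive.
Import Order.TTheory GRing.Theory Num.Theory.
Local Open Scope ring_scope.

(** Write q_f = s_f / deg f and M_f for the maximal multiplicity.

    Lower bound. By density every lattice vector is an integer combination
    k r1 + r2 of lattice vectors with small perpendicular parts, and A sends the
    parallel parts of those to parallel parts of lattice vectors with bounded
    perpendicular parts; hence A is induced by an integer matrix B of the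
    lattice, L B = diag(A, T) L for a real T. The multiplicity of z in char B is
    the same for all roots z of f, so it is at least M_f. If it were equal to
    every m_A(z), then f(T) would be invertible, so that an integer vector
    killed by f(B) would have zero perpendicular part, against genericity.

    Existence. Let B be integral with characteristic polynomial prod f^q_f and
    p(B) = 0. By (P2), and by Kronecker's theorem on roots of unity for the
    non-cyclotomic f, the quotient char B / char A has degree at least 1 and all
    its roots in the closed unit disc; it is the characteristic polynomial of a
    contraction A' with p(A') = 0, built from real 1x1 and 2x2 blocks. The unit
    ball is then an invariant window as soon as L B = diag(A, A') L. The map
    G |-> sum_k T^k G p_k(B), with (p(X) - p(Y)) / (X - Y) = sum_k X^k p_k(Y),
    parametrises all the intertwiners, and genericity of L means avoiding
    countably many nonzero polynomials in the real entries of G; density is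
    Kronecker's theorem for the dual lattice. *)

(** * Polynomials and multiplicities of roots *)

Lemma irredp_separable (F : numFieldType) (f : {poly F}) :
  irreducible_poly f -> separable_poly f.
Proof.
move=> f_irr; have f0 := irredp_neq0 f_irr; have f_gt1 := f_irr.1.
rewrite unlock irreducible_poly_coprime //.
have d0 : f^`() != 0.
  apply/eqP => /(congr1 (fun q : {poly F} => q`_(size f).-2)).
  rewrite coef_deriv coef0 => /eqP; rewrite mulrn_eq0 /=.
  have -> : (size f).-2.+1 = (size f).-1 by case: (size f) f_gt1 => [|[]].
  by rewrite -/(lead_coef f) lead_coef_eq0 (negPf f0).
by apply/negP => /(dvdp_leq d0); rewrite leqNgt lt_size_deriv.
Qed.

Lemma irredp_coprime_neq (F : fieldType) (f g : {poly F}) :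
  f \is monic -> g \is monic -> irreducible_poly f -> irreducible_poly g ->
  f != g -> coprimep f g.
Proof.
move=> fm gm fi gi; apply: contra_neqT; rewrite irreducible_poly_coprime // negbK.
move=> fg; have := gi.2 f; rewrite gtn_eqF; last exact: fi.1.
by move=> /(_ isT fg); rewrite eqp_monic // => /eqP.
Qed.

Lemma coprimep_prodr (F : fieldType) (I : eqType) (r : seq I) (f : {poly F}) (E : I -> {poly F}) :
  (forall i, i \in r -> coprimep f (E i)) -> coprimep f (\prod_(i <- r) E i).
Proof.
move=> h; rewrite big_seq; elim/big_rec: _ => [|i q ir IH]; first exact: coprimep1.
by rewrite coprimepMr h.
Qed.

Lemma separable_prod_irredp (F : numFieldType) (fs : seq {poly F}) :
  uniq fs -> all (fun f => f \is monic) fs ->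
  (forall f, f \in fs -> irreducible_poly f) ->
  separable_poly (\prod_(f <- fs) f).
Proof.
elim: fs => [|f fs IH] /= => [_ _ _|/andP[ffs ufs] /andP[fm am] irr].
  by rewrite big_nil unlock coprime1p.
have irr' g : g \in fs -> irreducible_poly g by move=> gfs; apply: irr; rewrite inE gfs orbT.
rewrite big_cons separable_mul irredp_separable ?IH //=; last by apply: irr; rewrite mem_head.
apply: coprimep_prodr => g gfs; apply: irredp_coprime_neq => //.
- exact: (allP am).
- by apply: irr; rewrite mem_head.
- exact: irr'.
- by apply: contraNneq ffs => ->.
Qed.

Lemma prod_dvdp_coprime (F : fieldType) (I : eqType) (r : seq I)
    (E : I -> {poly F}) (q : {poly F}) :
  uniq r -> {in r &, forall i j, i != j -> coprimep (E i) (E j)} ->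
  (forall i, i \in r -> E i %| q) -> \prod_(i <- r) E i %| q.
Proof.
elim: r => [|i r IH] /=; first by rewrite big_nil dvd1p.
move=> /andP[ir ur] cop dv; rewrite big_cons Gauss_dvdp.
  rewrite dv ?mem_head //= IH //.
    by move=> j k jr kr; apply: cop; rewrite inE ?jr ?kr orbT.
  by move=> j jr; apply: dv; rewrite inE jr orbT.
apply: coprimep_prodr => j jr; apply: cop; rewrite ?mem_head ?inE ?jr ?orbT //.
by apply: contraNneq ir => ->.
Qed.

(** Otherwise the irreducible f is coprime to q, and a Bezout relation survives the base change
    [phi], which excludes a common root. *)
Lemma irredp_dvd_of_root (F : fieldType) (K : fieldType) (phi : {rmorphism F -> K})
    (f q : {poly F}) (z : K) :
  irreducible_poly f -> root (map_poly phi f) z -> root (map_poly phi q) z -> f %| q.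
Proof.
move=> f_irr fz qz; apply: contraLR qz; rewrite -irreducible_poly_coprime // => cop.
by apply: (coprimep_root _ fz); rewrite coprimep_map.
Qed.

Lemma map_poly_neq0 (F K : fieldType) (phi : {rmorphism F -> K}) (q : {poly F}) :
  q != 0 -> map_poly phi q != 0.
Proof. by rewrite map_poly_eq0. Qed.

Lemma mup_separable (F : fieldType) (q : {poly F}) z :
  separable_poly q -> mup z q = root q z :> nat.
Proof.
move=> sq; have q0 := separable_poly_neq0 sq.
case: (boolP (root q z)) => [qz|/mupNroot -> //].
apply/eqP; rewrite eqn_leq -XsubC_dvd // dvdp_XsubCl qz andbT mup_leq //.
by rewrite (separable_nosquare sq) ?size_XsubC.
Qed.

Lemma mup_exp (F : fieldType) (q : {poly F}) z n :
  q != 0 -> mup z (q ^+ n) = (n * mup z q)%N.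
Proof.
move=> q0; elim: n => [|n IH]; first by rewrite expr0 mupNroot // root1.
by rewrite exprS mupM ?expf_neq0 // IH mulSn.
Qed.

Lemma mup_prod (F : fieldType) (I : eqType) (r : seq I) (E : I -> {poly F}) z :
  (forall i, i \in r -> E i != 0) ->
  mup z (\prod_(i <- r) E i) = (\sum_(i <- r) mup z (E i))%N.
Proof.
elim: r => [|i r IH] h; first by rewrite !big_nil mupNroot // root1.
have h' j : j \in r -> E j != 0 by move=> jr; apply: h; rewrite inE jr orbT.
rewrite !big_cons mupM ?IH // ?h ?mem_head //.
by rewrite prodf_seq_neq0; apply/allP => j jr; apply/implyP => _; apply: h'.
Qed.

Lemma irredp_mulpow (F : fieldType) (f q : {poly F}) :
  irreducible_poly f -> q != 0 ->
  exists k h, [/\ q = f ^+ k * h, coprimep f h & h != 0].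
Proof.
move=> fi; have [n] := ubnP (size q); elim: n q => // n IH q sq q0.
case: (boolP (f %| q)) => [/dvdpP[r qE]|fq]; last first.
  by exists 0%N, q; rewrite expr0 mul1r irreducible_poly_coprime.
have f0 := irredp_neq0 fi.
have r0 : r != 0 by apply: contraNneq q0 => r0; rewrite qE r0 mul0r.
have [|k [h [rE ch h0]]] := IH r _ r0.
  by have := fi.1; move: sq; rewrite qE size_mul // => h1 h2; move: (size r) (size f) h1 h2 => a b h1 h2; lia.
by exists k.+1, h; split => //; rewrite qE rE exprS mulrC mulrA.
Qed.

(** Conjugates have equal multiplicity: in q = f^k h with h coprime to f, the separable f
    contributes exactly k at each of its roots and h contributes nothing. *)
Lemma irredp_mup (F K : numFieldType) (phi : {rmorphism F -> K}) (f q : {poly F}) :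
  irreducible_poly f -> q != 0 ->
  exists k, f ^+ k %| q /\
    forall z, root (map_poly phi f) z -> mup z (map_poly phi q) = k.
Proof.
move=> fi q0; have [k [h [qE ch h0]]] := irredp_mulpow fi q0.
exists k; split; first by rewrite qE dvdp_mulr.
move=> z fz; have f0 := irredp_neq0 fi.
rewrite qE rmorphM rmorphXn /= mupMl.
  rewrite mup_exp ?map_poly_neq0 // mup_separable ?fz ?muln1 //.
  by rewrite separable_map irredp_separable.
by apply: (coprimep_root _ fz); rewrite coprimep_map.
Qed.

(** Induction on the degree: a root of a is a root of b, and removing the linear factor from both
    keeps the inequality between multiplicities. *)
Lemma mup_dvdp (F : closedFieldType) (a b : {poly F}) :
  a != 0 -> b != 0 -> (forall z, (mup z a <= mup z b)%N) -> a %| b.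
Proof.
have [n] := ubnP (size a); elim: n a b => // n IH a b sa a0 b0 le_ab.
have [a1|a1] := eqVneq (size a) 1%N.
  by move/eqP: a1; rewrite size_poly_eq1 => /eqp_dvdl ->; rewrite dvd1p.
have /closed_rootP[z az] := a1.
have bz : root b z.
  apply: contraLR (le_ab z) => /mupNroot ->.
  by rewrite -ltnNge -XsubC_dvd // dvdp_XsubCl.
move: az bz; rewrite -!dvdp_XsubCl => /dvdpP[a' aE] /dvdpP[b' bE].
have a'0 : a' != 0 by apply: contraNneq a0 => h; rewrite aE h mul0r.
have b'0 : b' != 0 by apply: contraNneq b0 => h; rewrite bE h mul0r.
have x0 : 'X - z%:P != 0 :> {poly F} by rewrite polyXsubC_eq0.
rewrite aE bE dvdp_mul2r // IH //.
  by move: sa; rewrite aE size_Mmonic ?monicXsubC // size_XsubC addn2.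
by move=> w; have := le_ab w; rewrite aE bE !mupM // leq_add2r.
Qed.

(** Gauss's lemma: f divides the monic integral q, so a rational multiple g of f divides q over the
    integers, and its leading coefficient, a divisor of 1, is a sign. *)
Lemma monic_irredp_int (K : numFieldType) (f : {poly rat}) (q : {poly int}) (z : K) :
  f \is monic -> irreducible_poly f -> root (map_poly ratr f) z ->
  q \is monic -> root (map_poly intr q) z ->
  exists2 g : {poly int}, g \is monic & f = map_poly intr g.
Proof.
move=> fm fi fz qm qz.
have : f %| map_poly intr q.
  apply: (irredp_dvd_of_root fi fz); rewrite -map_poly_comp.
  by rewrite (eq_map_poly (g := intr)) // => x /=; rewrite ratr_int.
case/dvdpP_rat_int => g [a a0 fE] [r qE].
have lg : lead_coef g = 1 \/ lead_coef g = -1.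
  have := congr1 (fun p : {poly int} => absz (lead_coef p)) qE.
  rewrite /= lead_coefM (eqP qm) abszM => /esym/eqP; rewrite muln_eq1 => /andP[/eqP + _].
  by move: (lead_coef g) => c; lia.
have fE' : a * (lead_coef g)%:~R = 1.
  have := eqP fm; rewrite {1}fE lead_coefZ lead_coef_map_inj //.
  exact: intr_inj.
exists ((lead_coef g) *: g).
  rewrite monicE lead_coefZ.
  by case: lg => ->.
rewrite map_polyZ /= fE; congr (_ *: _).
case: lg fE' => ->; first by rewrite mulr1.
by rewrite rmorphN1 mulrN1 => h; rewrite -[LHS]opprK h.
Qed.

(** * Roots of unity and diagonalization *)

(** A complex algebraic root z of f is a primitive k-th root of unity for some k, and f is its
    minimal polynomial, which is ['Phi_k]. *)
Lemma cyclotomic_of_dvd (f : {poly rat}) e :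
  f \is monic -> irreducible_poly f -> (0 < e)%N -> f %| 'X^e - 1 -> is_cyclotomic f.
Proof.
move=> fm fi e0 fe.
have /closed_rootP[z fz] : size (map_poly (ratr : rat -> algC) f) != 1%N.
  by rewrite size_map_poly gtn_eqF // fi.1.
have ze : z ^+ e = 1.
  have : root (map_poly (ratr : rat -> algC) ('X^e - 1)) z.
    by move: fe; rewrite -(dvdp_map (ratr : {rmorphism rat -> algC})) => /dvdpP[q ->]; rewrite rootM fz orbT.
  by rewrite rmorphB /= rmorph1 map_polyXn rootE !hornerE subr_eq0 => /eqP.
have [k zk _] := prim_order_exists e0 ze.
exists k; split; first exact: prim_order_gt0 zk.
have [q [zq qm] rq] := minCpolyP z.
have qf : q %| f by rewrite -rq.
have fq : f %| q.
  by apply: (irredp_dvd_of_root fi fz); rewrite rq.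
have -> : f = q by apply/eqP; rewrite -eqp_monic // /eqp fq qf.
apply: (@map_poly_inj _ _ (ratr : {rmorphism rat -> algC})).
rewrite -zq (minCpoly_cyclotomic zk) -(Cintr_Cyclotomic zk) -map_poly_comp.
by apply: eq_map_poly => x /=; rewrite ratr_int.
Qed.

Lemma separable_annul_diag (F : closedFieldType) n (M : 'M[F]_n.+1) (q : {poly F}) :
  separable_poly q -> horner_mx M q = 0 ->
  exists P d, P \in unitmx /\ P *m M = diag_mx d *m P.
Proof.
move=> sq Mq; have : diagonalizable M.
  apply/diagonalizableP; have [r qE] := closed_field_poly_normal q.
  have q0 := separable_poly_neq0 sq; exists r.
    by rewrite -separable_prod_XsubC; move: sq; rewrite qE (eqp_separable (eqp_scale _ _)) // lead_coef_eq0.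
  by move: (mxminpoly_min Mq); rewrite {1}qE dvdpZr // lead_coef_eq0.
case=> P uP /diagonalizable_forPex[d /(simmxP uP) PM].
by exists P, d.
Qed.

Lemma char_poly_similar (F : fieldType) n (P M N : 'M[F]_n) :
  P \in unitmx -> P *m M = N *m P -> char_poly M = char_poly N.
Proof.
move=> uP PM.
have : map_mx polyC P *m char_poly_mx M = char_poly_mx N *m map_mx polyC P.
  by rewrite mulmxBr mulmxBl -!map_mxM PM scalar_mxC.
move/(congr1 determinant); rewrite !det_mulmx mulrC => /mulIf; apply.
by rewrite det_map_mx polyC_eq0 -unitfE -unitmxE.
Qed.

Lemma char_poly_diag (F : fieldType) n (d : 'rV[F]_n) :
  char_poly (diag_mx d) = \prod_i ('X - (d 0 i)%:P).
Proof.
rewrite char_poly_trig ?diag_mx_is_trig //.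
by apply: eq_bigr => i _; rewrite mxE eqxx.
Qed.

Lemma pigeonhole (I T : finType) (f : I -> T) :
  (#|T| < #|I|)%N -> exists i j, i != j /\ f i = f j.
Proof.
move=> lt; have /injectivePn[i [j ij fij]] : ~~ injectiveb f.
  by apply: contraL lt => /injectiveP /leq_card; rewrite -leqNgt.
by exists i, j.
Qed.

(** * Kronecker's theorem on roots of unity *)

Section Kronecker.
Variable R : realType.
Local Notation C := R[i].

Lemma complex_nat_bound (c : C) : 0 <= c -> exists N : nat, c <= N%:R.
Proof.
move=> c0; have cE : c = (complex.Re c)%:C%C by rewrite RRe_real // ger0_real.
exists (Num.bound (complex.Re c)); rewrite cE -(rmorph_nat (real_complex R)) lecR.
by apply/ltW/archi_boundP; rewrite -ler0c -cE.
Qed.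

(** M^k = P^-1 D^k P, where the diagonal entries of D^k stay in the closed unit disc, so the entries
    are bounded in terms of P alone. *)
Lemma int_matrix_pow_bounded n (M : 'M[int]_n.+1) (P : 'M[C]_n.+1) d :
  P \in unitmx -> P *m map_mx intr M = diag_mx d *m P -> (forall i, `|d 0 i| <= 1) ->
  exists N : nat, forall k i j, (`|(M ^+ k) i j| <= N)%N.
Proof.
move=> uP PM d1.
(* Summing over all i and j gives one bound for every entry. *)
pose c := \sum_i \sum_j \sum_l `|invmx P i l| * `|P l j|.
have [N cN] : exists N : nat, c <= N%:R.
  apply: complex_nat_bound; apply: sumr_ge0 => i _; apply: sumr_ge0 => j _.
  by apply: sumr_ge0 => l _; apply: mulr_ge0.
exists N => k i j.
rewrite -(ler_nat C); apply: le_trans cN.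
have PMk : P *m map_mx intr (M ^+ k) = diag_mx (map_mx (fun x => x ^+ k) d) *m P.
  elim: k => [|k IH].
    rewrite expr0 map_mx1 mulmx1 -[LHS]mul1mx; congr (_ *m _).
    by apply/matrixP=> a b; rewrite !mxE expr0.
  rewrite exprSr -mulmxE map_mxM mulmxA IH -mulmxA PM mulmxA; congr (_ *m _).
  rewrite mulmx_diag; congr diag_mx; apply/rowP => a; by rewrite !mxE exprSr.
have -> : `|(M ^+ k) i j|%:R = `|(map_mx intr (M ^+ k) : 'M[C]_n.+1) i j|.
  by rewrite mxE -intr_norm -abszE.
rewrite -[map_mx _ _](mulKmx uP) PMk.
rewrite mul_diag_mx.
apply: (@le_trans _ _ (\sum_l `|invmx P i l| * `|P l j|)).
  rewrite mxE; apply: le_trans (ler_norm_sum _ _ _) _; apply: ler_sum => l _.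
  rewrite !mxE !normrM ler_wpM2l // ler_piMl // normrX.
  by apply: exprn_ile1.
apply: (@le_trans _ _ (\sum_j' \sum_l `|invmx P i l| * `|P l j'|)).
  rewrite [leRHS](bigD1 j) //= lerDl.
  by apply: sumr_ge0 => *; apply: sumr_ge0 => *; apply: mulr_ge0.
rewrite /c [leRHS](bigD1 i) //= lerDl.
by apply: sumr_ge0 => *; apply: sumr_ge0 => *; apply: sumr_ge0 => *; apply: mulr_ge0.
Qed.

Lemma int_matrix_pow_repeat n (M : 'M[int]_n.+1) N :
  (forall k i j, (`|(M ^+ k) i j| <= N)%N) -> exists k l, (k < l)%N /\ M ^+ k = M ^+ l.
Proof.
move=> bN.
pose T := 'M['I_(N + N).+1]_n.+1.
(* The shift by N sends entries in [-N, N] injectively to [0, 2N], where [inord] loses nothing. *)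
pose f (k : 'I_(#|T|).+1) : T := map_mx (fun m => inord (absz (m + N%:Z))) (M ^+ k).
have [|a [b [ab fab]]] := @pigeonhole _ _ f; first by rewrite card_ord.
have E : M ^+ a = M ^+ b.
  apply/matrixP=> i j; have := bN a i j; have := bN b i j.
  have /matrixP/(_ i j) := fab; rewrite !mxE => /(congr1 val).
  move: ((M ^+ a) i j) ((M ^+ b) i j) => x y /= H hy hx; move: H.
  by rewrite !inordK; lia.
have [lt|lt|/val_inj ab'] := ltngtP a b.
- by exists a, b.
- by exists b, a.
- by rewrite ab' eqxx in ab.
Qed.

Lemma exists_companion (K : comNzRingType) (g : {poly K}) :
  g \is monic -> (1 < size g)%N -> exists n (M : 'M[K]_n.+1), char_poly M = g.
Proof.
move=> gm; move: (companionmxK gm); move: (companionmx g).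
case: (size g) => [|[|m]] //= M ME _; by exists m, M.
Qed.

(** The companion matrix of g is integral and diagonalizable with eigenvalues in the closed unit
    disc, so two of its powers coincide. A nonzero eigenvalue z then satisfies z^k = z^l with k < l
    and is a root of unity. *)
Lemma Kronecker_cyclotomic (f : {poly rat}) (g : {poly int}) :
  f \is monic -> irreducible_poly f -> g \is monic -> f = map_poly intr g ->
  ~~ root f 0 -> (forall z : C, root (map_poly ratr f) z -> `|z| <= 1) ->
  is_cyclotomic f.
Proof.
move=> fm fi gm fg f0 small.
have fgC : map_poly ratr f = map_poly intr g :> {poly C}.
  by rewrite fg -map_poly_comp; apply: eq_map_poly => x /=; rewrite ratr_int.
have sg : (1 < size g)%N.
  by have := fi.1; rewrite fg size_map_inj_poly //; exact: intr_inj.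
have [n [M ME]] := exists_companion gm sg.
have MC : horner_mx (map_mx intr M : 'M[C]_n.+1) (map_poly ratr f) = 0.
  by rewrite fgC -map_horner_mx -ME Cayley_Hamilton map_mx0.
have sf : separable_poly (map_poly ratr f : {poly C}).
  by rewrite separable_map irredp_separable.
have [P [d [uP PM]]] := separable_annul_diag sf MC.
have dr i : root (map_poly ratr f) (d 0 i).
  rewrite fgC -ME map_char_poly (char_poly_similar uP PM) char_poly_diag.
  by rewrite (bigD1 i) //= rootM root_XsubC eqxx.
have [N bN] := int_matrix_pow_bounded uP PM (fun i => small _ (dr i)).
have [k [l [kl Mkl]]] := int_matrix_pow_repeat bN.
pose z := d 0 0.
have z0 : z != 0.
  apply: contraNneq f0 => z0; move: (dr 0); rewrite -/z z0 -(rmorph0 ratr).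
  by rewrite fmorph_root.
(* The rows of P are left eigenvectors; the first one transfers M^k = M^l to the eigenvalue z. *)
have eig m : row 0 P *m map_mx intr (M ^+ m) = z ^+ m *: row 0 P.
  elim: m => [|m IH]; first by rewrite expr0 map_mx1 mulmx1 expr0 scale1r.
  rewrite exprSr -mulmxE map_mxM mulmxA IH -scalemxAl -row_mul PM exprSr -scalerA.
  by congr (_ *: _); apply/rowP => j; rewrite mul_diag_mx !mxE.
have zkl : z ^+ k = z ^+ l.
  have : z ^+ k *: row 0 P = z ^+ l *: row 0 P by rewrite -!eig Mkl.
  move/eqP; rewrite -subr_eq0 -scalerBl scaler_eq0 subr_eq0 => /orP[/eqP //|/eqP r0].
  have : row 0 P *m invmx P = 0 by rewrite r0 mul0mx.
  rewrite -row_mul mulmxV // => /rowP/(_ 0); rewrite !mxE eqxx => /eqP.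
  by rewrite oner_eq0.
apply: (@cyclotomic_of_dvd f (l - k)) => //; first by rewrite subn_gt0.
apply: (irredp_dvd_of_root fi (dr 0)).
rewrite rmorphB /= rmorph1 map_polyXn rootE !hornerE subr_eq0.
have zk0 : z ^+ k != 0 by rewrite expf_neq0.
by apply/eqP/(mulfI zk0); rewrite -exprD subnKC 1?ltnW // mulr1.
Qed.

End Kronecker.

(** * Intertwiners of matrices killed by a polynomial *)

(** The explicit dimension reads [m.+1 + n.+1] as the successor of [m + n.+1], since [horner_mx]
    takes matrices of successor size. *)
Lemma horner_mx_block (K : comNzRingType) m n (M : 'M[K]_m.+1) (N : 'M[K]_n.+1) q :
  @horner_mx K (m + n.+1) (block_mx M 0 0 N) q = block_mx (horner_mx M q) 0 0 (horner_mx N q).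
Proof.
elim/poly_ind: q => [|q c IH].
  by rewrite !rmorph0; exact/esym/(@block_mx_const _ m.+1 n.+1 m.+1 n.+1 0).
rewrite !rmorphD !rmorphM /= !horner_mx_X !horner_mx_C IH.
have E := @mulmx_block _ m.+1 n.+1 m.+1 n.+1 m.+1 n.+1 (horner_mx M q) 0 0 (horner_mx N q) M 0 0 N.
apply: etrans (congr1 (fun X => X + c%:M) E) _.
rewrite !mulmx0 !mul0mx !addr0 !add0r.
apply: etrans (congr1 (fun X => _ + X) (@scalar_mx_block _ m.+1 n.+1 c)) _.
by rewrite (@add_block_mx _ m.+1 n.+1 m.+1 n.+1) !addr0.
Qed.

Lemma char_poly_block (K : comNzRingType) m n (M : 'M[K]_m) (N : 'M[K]_n) :
  char_poly (block_mx M 0 0 N) = char_poly M * char_poly N.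
Proof. by rewrite /char_poly char_block_diag_mx det_ublock. Qed.

Lemma horner_mx_tr (K : comNzRingType) n (M : 'M[K]_n.+1) q :
  (horner_mx M q)^T = horner_mx M^T q.
Proof.
elim/poly_ind: q => [|q c IH]; first by rewrite !rmorph0 trmx0.
rewrite !rmorphD !rmorphM /= !horner_mx_X !horner_mx_C linearD /= tr_scalar_mx.
rewrite -mulmxE trmx_mul IH; congr (_ + _).
by apply: comm_mx_horner.
Qed.

(** Block diagonal sum of companion matrices. A common multiple of the factors kills every block by
    Cayley-Hamilton, so repeated factors do not force a repeated factor in q. The ring may be the
    integers, hence divisibility by an explicit cofactor. *)
Lemma exists_matrix_prod (K : comNzRingType) (gs : seq {poly K}) :
  (forall g, g \in gs -> g \is monic /\ (1 < size g)%N) -> gs != [::] ->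
  exists n (M : 'M[K]_n.+1), char_poly M = \prod_(g <- gs) g /\
    forall q, (forall g, g \in gs -> exists h, q = h * g) -> horner_mx M q = 0.
Proof.
elim: gs => // g gs IH hgs _.
have [gm sg] := hgs _ (mem_head _ _).
have [m [M ME]] := exists_companion gm sg.
have Mq q : (exists h, q = h * g) -> horner_mx M q = 0.
  by case=> h ->; rewrite rmorphM /= -ME Cayley_Hamilton mulr0.
case: gs IH hgs => [|g' gs] IH hgs.
  exists m, M; split; first by rewrite big_seq1.
  by move=> q hq; apply/Mq/hq/mem_head.
have [n [N [NE Nq]]] : exists n (M0 : 'M[K]_n.+1), char_poly M0 = \prod_(g <- g' :: gs) g /\
    forall q, (forall g, g \in g' :: gs -> exists h, q = h * g) -> horner_mx M0 q = 0.
  by apply: IH => // f fgs; apply: hgs; rewrite inE fgs orbT.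
exists (m + n.+1)%N, (block_mx M 0 0 N); split.
  by rewrite big_cons -ME -NE -char_poly_block.
move=> q hq; rewrite horner_mx_block Mq ?Nq.
- exact: (@block_mx_const _ m.+1 n.+1 m.+1 n.+1 0).
- by move=> f fgs; apply: hq; rewrite inE fgs orbT.
- by apply: hq; rewrite mem_head.
Qed.

(** * The Casimir parametrization of intertwiners *)

Section Intertwiner.
Variables (F : fieldType) (n : nat) (p : {poly F}).
Implicit Types T B G : 'M[F]_n.+1.

(* The Casimir element (p(X) - p(Y)) / (X - Y) = \sum_k X^k p_k(Y) of
   F[X]/(p), with p_k = drop_poly k.+1 p, turns any G into an intertwiner. *)
Definition casimir T B G : 'M[F]_n.+1 :=
  \sum_(k < size p) T ^+ k *m G *m horner_mx B (drop_poly k.+1 p).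

(** Horner's recursion, which makes the sums below telescope. *)
Lemma drop_polyS k : drop_poly k p = drop_poly k.+1 p * 'X + (p`_k)%:P.
Proof.
apply/polyP => i; rewrite coefD coefMX coefC !coef_drop_poly.
by case: i => [|i] /=; rewrite ?add0r // addr0 addnS addSn.
Qed.

(** The difference of the two sides telescopes, up to the extra term p(T) G; what remains is p(T) G
    and the boundary term G p(B), both zero. *)
Lemma casimir_intertwines T B G :
  horner_mx T p = 0 -> horner_mx B p = 0 -> T *m casimir T B G = casimir T B G *m B.
Proof.
move=> pT pB.
have hB k : horner_mx B (drop_poly k.+1 p) *m B =
    horner_mx B (drop_poly k p) - (p`_k)%:M.
  rewrite [in RHS]drop_polyS rmorphD rmorphM /= horner_mx_X horner_mx_C addrK.
  by rewrite mulmxE.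
rewrite /casimir mulmx_sumr mulmx_suml.
pose D k : 'M[F]_n.+1 := T ^+ k *m G *m horner_mx B (drop_poly k p).
have E1 (k : nat) : T *m (T ^+ k *m G *m horner_mx B (drop_poly k.+1 p)) = D k.+1.
  by rewrite /D exprS -mulmxE !mulmxA.
have E2 (k : nat) : T ^+ k *m G *m horner_mx B (drop_poly k.+1 p) *m B =
     D k - (p`_k *: T ^+ k) *m G.
  rewrite -mulmxA hB mulmxBr -/(D k); congr (_ - _).
  by rewrite mul_mx_scalar scalemxAl.
rewrite (eq_bigr (fun k : 'I__ => D k.+1)) => [|k _]; last exact: E1.
rewrite [RHS](eq_bigr (fun k : 'I__ => D k - (p`_k *: T ^+ k) *m G)) => [|k _]; last exact: E2.
rewrite sumrB -mulmx_suml.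
have -> : \sum_(k < size p) p`_k *: T ^+ k = horner_mx T p.
  rewrite -[in RHS](coefK p) poly_def raddf_sum /=; apply: eq_bigr => k _.
  by rewrite horner_mxZ rmorphXn /= horner_mx_X.
rewrite pT mul0mx subr0; apply/eqP; rewrite -subr_eq0 -sumrB.
rewrite -(big_mkord xpredT (fun k => D k.+1 - D k)) telescope_sumr //.
by rewrite /D drop_poly0l drop_poly_eq0 // pB rmorph0 !mulmx0 subr0.
Qed.

(** On y the variable X of the Casimir element acts as l, and (p(l) - p(Y)) / (l - Y) = p(Y) / (Y -
    l) because p(l) = 0. *)
Lemma casimir_left_eigen T B G (y : 'rV_n.+1) (l : F) :
  root p l -> y *m T = l *: y ->
  y *m casimir T B G = y *m G *m horner_mx B (p %/ ('X - l%:P)).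
Proof.
move=> pl yT.
have yTk k : y *m T ^+ k = l ^+ k *: y.
  elim: k => [|k IH]; first by rewrite !expr0 mulmx1 scale1r.
  by rewrite exprS -mulmxE mulmxA yT -scalemxAl IH scalerA -exprS.
have -> : p %/ ('X - l%:P) = \sum_(k < size p) l ^+ k *: drop_poly k.+1 p.
  have x0 : 'X - l%:P != 0 :> {poly F} by rewrite polyXsubC_eq0.
  apply: (mulIf x0); rewrite divpK ?dvdp_XsubCl // mulr_suml.
  pose D k : {poly F} := l ^+ k *: drop_poly k p.
  have E (k : 'I_(size p)) : (l ^+ k *: drop_poly k.+1 p) * ('X - l%:P) =
      D k - D k.+1 - (p`_k * l ^+ k)%:P.
    rewrite /D [drop_poly k p]drop_polyS -!mul_polyC exprS !polyCM; ring.
  rewrite (eq_bigr _ (fun k _ => E k)) sumrB -raddf_sum /= -horner_coef (rootP pl) subr0.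
  rewrite -(big_mkord xpredT (fun k => D k - D k.+1)).
  apply: oppr_inj; rewrite -sumrN (eq_bigr (fun k => D k.+1 - D k)) => [|k _]; last by rewrite opprB.
  rewrite telescope_sumr // /D drop_poly0l drop_poly_eq0 //.
  by rewrite scaler0 sub0r expr0 scale1r.
rewrite /casimir !mulmx_sumr raddf_sum mulmx_sumr; apply: eq_bigr => k _.
by rewrite /= !mulmxA yTk linearZ /= -!scalemxAl -scalemxAr.
Qed.

(** The mirror case: here Y acts as l on x, leaving p(X) / (X - l). *)
Lemma casimir_right_eigen T B G (x : 'cV_n.+1) (l : F) :
  root p l -> B *m x = l *: x ->
  casimir T B G *m x = horner_mx T (p %/ ('X - l%:P)) *m G *m x.
Proof.
move=> pl Bx.
have qx q : horner_mx B q *m x = q.[l] *: x.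
  elim/poly_ind: q => [|q c IH]; first by rewrite rmorph0 mul0mx horner0 scale0r.
  rewrite rmorphD rmorphM /= horner_mx_X horner_mx_C mulmxDl -mulmxA Bx -scalemxAr IH.
  by rewrite mul_scalar_mx hornerMXaddC scalerDl scalerA mulrC.
have -> : p %/ ('X - l%:P) = \sum_(k < size p) (drop_poly k.+1 p).[l] *: 'X^k.
  have x0 : 'X - l%:P != 0 :> {poly F} by rewrite polyXsubC_eq0.
  apply: (mulIf x0); rewrite divpK ?dvdp_XsubCl // mulr_suml.
  pose D k : {poly F} := (drop_poly k p).[l] *: 'X^k.
  have E (k : 'I_(size p)) : ((drop_poly k.+1 p).[l] *: 'X^k) * ('X - l%:P) =
      (D k.+1 - D k) + p`_k *: 'X^k.
    rewrite /D [drop_poly k p]drop_polyS hornerMXaddC -!mul_polyC exprS !polyCD !polyCM; ring.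
  rewrite (eq_bigr _ (fun k _ => E k)) big_split /=.
  rewrite -(big_mkord xpredT (fun k => D k.+1 - D k)) telescope_sumr //.
  rewrite {1}/D drop_poly_eq0 // horner0 scale0r sub0r /D drop_poly0l (rootP pl) scale0r oppr0.
  by rewrite add0r -poly_def coefK.
rewrite /casimir mulmx_suml raddf_sum !mulmx_suml; apply: eq_bigr => k _.
rewrite /= horner_mxZ rmorphXn /= horner_mx_X -!mulmxA qx.
by rewrite -!scalemxAr -scalemxAl.
Qed.

(** An intertwiner S moves powers of T across to powers of B, which sets X = Y in the Casimir
    element and turns it into p'(B). Separability gives v with v p' = 1 modulo p, and G = S v(B) is
    a preimage of S. *)
Lemma casimir_surj T B S :
  separable_poly p -> horner_mx B p = 0 -> T *m S = S *m B ->
  exists G, casimir T B G = S.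
Proof.
move=> sp Bp TS.
have /Bezout_eq1_coprimepP[[u v] /= uv] : coprimep p p^`() by move: sp; rewrite unlock.
have TkS k : T ^+ k *m S = S *m B ^+ k.
  elim: k => [|k IH]; first by rewrite !expr0 mul1mx mulmx1.
  by rewrite exprSr -mulmxE -mulmxA TS mulmxA IH exprSr -mulmxE mulmxA.
exists (S *m horner_mx B v).
rewrite /casimir (eq_bigr (fun k : 'I__ => S *m horner_mx B v *m
   horner_mx B ('X^k * drop_poly k.+1 p))) => [|k _]; last first.
  rewrite mulmxA TkS rmorphM rmorphXn /= horner_mx_X -mulmxE !mulmxA.
  by congr (_ *m _); rewrite -!mulmxA; congr (_ *m _); apply/esym/commrX/commr_sym; exact: comm_mx_horner.
rewrite -mulmx_sumr -raddf_sum /=.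
(* The coefficient p_(i+1) reaches degree i once for each k in 0, ..., i, that is, i + 1 times, as
   in the derivative. *)
have -> : \sum_(k < size p) 'X^k * drop_poly k.+1 p = p^`().
  apply/polyP => i; rewrite coef_sum coef_deriv.
  under eq_bigr => k _ do rewrite coefXnM coef_drop_poly.
  have [lt|le] := ltnP i.+1 (size p); last first.
    rewrite [p`_i.+1]nth_default // mul0rn big1 // => k _.
    by case: ltnP => // ki; rewrite addnS subnK // nth_default.
  rewrite (bigID (fun k : 'I_(size p) => k < i.+1)%N) /= [X in _ + X]big1 ?addr0; last first.
    by move=> k; rewrite -leqNgt => ->.
  rewrite (eq_bigr (fun _ => p`_i.+1)); last first.
    by move=> k ki; rewrite ltnNge -ltnS ki /= addnS subnK.
  rewrite sumr_const; congr (_ *+ _).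
  rewrite -sum1_card -(big_mkord (fun k => k < i.+1)%N (fun _ => 1%N)).
  have /= <- := @big_nat_widen _ _ addn 0 i.+1 (size p) xpredT (fun=> 1%N) (ltnW lt).
  by rewrite sum_nat_const_nat subn0 muln1.
rewrite -mulmxA mulmxE -rmorphM /= -[RHS]mulmx1; congr (_ *m _).
have -> : v * p^`() = 1 - u * p by rewrite -uv addrAC subrr add0r.
by rewrite rmorphB rmorphM /= Bp mulr0 subr0 rmorph1.
Qed.

End Intertwiner.

Lemma map_casimir (F K : fieldType) (phi : {rmorphism F -> K}) n (p : {poly F})
    (T B G : 'M[F]_n.+1) :
  map_mx phi (casimir p T B G) =
  casimir (map_poly phi p) (map_mx phi T) (map_mx phi B) (map_mx phi G).
Proof.
rewrite /casimir size_map_poly raddf_sum; apply: eq_bigr => k _.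
rewrite /= !map_mxM rmorphXn map_horner_mx; congr (_ *m horner_mx _ _).
by apply/polyP => i; rewrite !(coef_map, coef_drop_poly).
Qed.

Lemma casimirD (F : fieldType) n (p : {poly F}) (T B G H : 'M[F]_n.+1) t :
  casimir p T B (G + t *: H) = casimir p T B G + t *: casimir p T B H.
Proof.
rewrite /casimir scaler_sumr -big_split; apply: eq_bigr => k _ /=.
by rewrite mulmxDr mulmxDl -scalemxAr -scalemxAl.
Qed.

Lemma prod_deriv_rem (F : fieldType) (fs : seq {poly F}) :
  uniq fs -> (\prod_(f <- fs) f)^`() = \sum_(f <- fs) f^`() * \prod_(g <- rem f fs) g.
Proof.
elim: fs => [|f fs IH] /=; first by rewrite !big_nil derivC.
case/andP=> ffs ufs; rewrite !big_cons derivM IH // eqxx; congr (_ + _).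
rewrite mulr_sumr !big_seq; apply: eq_bigr => g gfs.
case: eqP => [fg|_]; first by rewrite fg gfs in ffs.
by rewrite big_cons mulrCA.
Qed.

(** * Components of rational vectors along the irreducible factors *)

Section RationalVectors.
Variables (K : numFieldType) (n : nat).
Local Notation rK := (ratr : rat -> K).

(* The iterates r, rM, rM^2, ... of a rational row killed by an irreducible f
   are free over Q up to deg f, hence over K, so that r sees every root of f. *)
Lemma irredp_cyclic_free (f : {poly rat}) (M : 'M[rat]_n.+1) (r : 'rV[rat]_n.+1) (h : {poly K}) :
  irreducible_poly f -> r != 0 -> r *m horner_mx M f = 0 ->
  h != 0 -> (size h < size f)%N ->
  map_mx rK r *m horner_mx (map_mx rK M) h != 0.
Proof.
move=> fi r0 rf h0 hf; pose d := (size f).-1.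
have f_gt1 := fi.1.
pose W : 'M[rat]_(d, n.+1) := \matrix_(k < d) (r *m M ^+ k).
(* Stated for any extension: it serves over the rationals to prove freeness and over K to use it. *)
have WE (E : fieldType) (phi : {rmorphism rat -> E}) (c : 'rV[E]_d) :
    c *m map_mx phi W = map_mx phi r *m horner_mx (map_mx phi M) (rVpoly c).
  rewrite mulmx_sum_row /rVpoly poly_def raddf_sum mulmx_sumr.
  apply: eq_bigr => k _; rewrite /= horner_mxZ rmorphXn /= horner_mx_X -scalemxAr.
  rewrite insubT // => ltk; congr (c 0 _ *: _); first exact: val_inj.
  by rewrite -map_row rowK map_mxM rmorphXn.
have freeW : row_free W.
  rewrite -kermx_eq0; apply/rowV0P => c /sub_kermxP cW.
  have := WE _ (idfun : {rmorphism rat -> rat}) c.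
  rewrite !map_mx_id // cW => /esym rc.
  apply/eqP; rewrite -[c]rVpolyK; apply/eqP.
  suff -> : rVpoly c = 0 by rewrite linear0.
  apply/eqP; apply: contraNT r0 => c0.
  have cop : coprimep f (rVpoly c).
    rewrite irreducible_poly_coprime //; apply/negP => /(dvdp_leq c0).
    have := size_poly d (fun k => if insub k is Some i then c 0 i else 0).
    rewrite -/(rVpoly c) /d; move: (size f) (size (rVpoly c)) f_gt1 => a b; lia.
  have /Bezout_eq1_coprimepP[[u v] /= uv] := cop.
  have E1 : horner_mx M (u * f + v * rVpoly c) = 1%:M.
    by apply: etrans (congr1 (horner_mx M) uv) _; rewrite rmorph1.
  rewrite -[r]mulmx1 -E1 [u * f]mulrC [v * _]mulrC rmorphD !rmorphM /= mulmxDr.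
  by rewrite -!mulmxE !mulmxA rf rc !mul0mx addr0.
have -> : h = rVpoly (poly_rV h : 'rV[K]_d).
  by rewrite poly_rV_K // /d; move: (size f) (size h) hf f_gt1 => a b; lia.
rewrite -WE; apply: contraNneq h0 => hW.
have : row_free (map_mx rK W) by rewrite row_free_map.
move/row_free_inj => /(_ _ (poly_rV h) 0); rewrite hW mul0mx => /(_ erefl) h0.
rewrite -[h](@poly_rV_K _ d) ?h0 ?linear0 //.
by rewrite /d; move: (size f) (size h) hf f_gt1 => a b; lia.
Qed.

(** Since p' = sum_f f' prod_(g != f) g is invertible modulo p, some prod_(g != f) g(M) does not
    kill r. The resulting rational vector is killed by f(M), and [irredp_cyclic_free] applies to it
    with the polynomial f / (X - l). *)
Lemma rational_component (fs : seq {poly rat}) (M : 'M[rat]_n.+1) (r : 'rV[rat]_n.+1) :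
  let p := \prod_(f <- fs) f in
  uniq fs -> all (fun f => f \is monic) fs -> (forall f, f \in fs -> irreducible_poly f) ->
  horner_mx M p = 0 -> r != 0 ->
  exists f, f \in fs /\ forall l : K, root (map_poly rK f) l ->
    map_mx rK r *m horner_mx (map_mx rK M) (map_poly rK p %/ ('X - l%:P)) != 0.
Proof.
move=> p ufs mfs ifs Mp r0.
have sp : separable_poly p by apply: separable_prod_irredp.
have [f ffs rf0] : exists2 f, f \in fs & r *m horner_mx M (\prod_(g <- rem f fs) g) != 0.
  apply/hasP; apply: contraNT r0 => /hasPn allz.
  have /Bezout_eq1_coprimepP[[u v] /= uv] : coprimep p p^`() by move: sp; rewrite unlock.
  have E1 : horner_mx M (u * p + v * p^`()) = 1%:M.
    by apply: etrans (congr1 (horner_mx M) uv) _; rewrite rmorph1.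
  rewrite -[r]mulmx1 -E1 rmorphD !rmorphM /= Mp mulr0 add0r.
  rewrite prod_deriv_rem // raddf_sum /= mulr_sumr mulmx_sumr big_seq big1 // => f ffs.
  rewrite rmorphM /= mulrA -rmorphM [_ * horner_mx _ _]comm_horner_mx2 -mulmxE mulmxA.
  by move: (allz f ffs); rewrite negbK => /eqP ->; rewrite mul0mx.
exists f; split => // l fl; have fi := ifs f ffs.
have pE : p = \prod_(g <- rem f fs) g * f by rewrite /p (big_rem f ffs) mulrC.
rewrite pE rmorphM /= -divp_mulA ?dvdp_XsubCl // rmorphM /= -mulmxE mulmxA.
rewrite -map_horner_mx -map_mxM (irredp_cyclic_free fi) //.
- by move: Mp; rewrite pE rmorphM /= -mulmxE -mulmxA => ->; rewrite mulmx0.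
- by rewrite divp_eq0 map_poly_eq0 (negPf (irredp_neq0 fi)) polyXsubC_eq0 /= -leqNgt size_XsubC size_map_poly fi.1.
- rewrite size_divp ?polyXsubC_eq0 // size_XsubC size_map_poly.
  by have := fi.1; move: (size f) => a; lia.
Qed.

End RationalVectors.

(** * Avoiding countably many polynomials *)

Local Open Scope classical_set_scope.
Local Open Scope ring_scope.

(** Both matrices are diagonalizable, and equal characteristic polynomials make the two diagonals
    permutations of each other. *)
Lemma similar_of_char_poly (F : closedFieldType) n (q : {poly F}) (M N : 'M[F]_n.+1) :
  separable_poly q -> horner_mx M q = 0 -> horner_mx N q = 0 ->
  char_poly M = char_poly N -> exists S, S \in unitmx /\ M *m S = S *m N.
Proof.
move=> sq Mq Nq; have [P [d [uP PM]]] := separable_annul_diag sq Mq.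
have [Q [e [uQ QN]]] := separable_annul_diag sq Nq.
rewrite (char_poly_similar uP PM) (char_poly_similar uQ QN) !char_poly_diag => de.
pose td (c : 'rV[F]_n.+1) := [tuple c 0 i | i < n.+1].
have tdE c : \prod_(x <- td c) ('X - x%:P) = \prod_i ('X - (c 0 i)%:P).
  by rewrite /= big_map enumT.
have /tuple_permP[s es] : perm_eq (td d) (td e) by apply: prod_XsubC_eq; rewrite !tdE.
have ds i : d 0 i = e 0 (s i).
  move/val_inj: es => /(congr1 (fun t => tnth t i)).
  by rewrite !tnth_mktuple.
have sE : diag_mx d *m perm_mx s = perm_mx s *m diag_mx e.
  apply/matrixP => i j; rewrite mul_diag_mx mul_mx_diag !mxE ds.
  by case: eqP => [->|_]; rewrite ?mul1r ?mulr1 ?mul0r ?mulr0.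
exists (invmx P *m perm_mx s *m Q); split.
  by rewrite !unitmx_mul unitmx_inv uP unitmx_perm uQ.
have -> : M = invmx P *m diag_mx d *m P by rewrite -mulmxA -PM mulKmx.
rewrite -!mulmxA QN mulKVmx // !mulmxA; congr (_ *m _).
by rewrite -[LHS]mulmxA sE mulmxA.
Qed.

Section Genericity.
Variable R : realType.
Local Notation C := R[i].
Local Notation rc := (real_complex R).
Local Notation cmx := (map_mx (real_complex R)).

(** The real roots of countably many nonzero polynomials form a countable set, of Lebesgue measure
    0, whereas [0, 1] has measure 1. *)
Lemma real_avoid (I : countType) (q : I -> {poly C}) :
  (forall i, q i != 0) -> exists t : R, forall i, (q i).[t%:C%C] != 0.
Proof.
move=> q0; pose Z i : set R := [set t : R | root (q i) t%:C%C].
have cZ : countable (\bigcup_(i in [set: I]) Z i).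
  apply: bigcup_countable => // i _; apply: finite_set_countable.
  have [r qE] := closed_field_poly_normal (q i).
  apply: (@sub_finite_set _ _ [set` map (@complex.Re R) r]) => // t /=.
  rewrite /Z /= qE rootZ ?lead_coef_eq0 // root_prod_XsubC => tr.
  by apply/mapP; exists t%:C%C.
have [allZ|] := pselect (setT `<=` \bigcup_(i in [set: I]) Z i).
  have c01 : countable (`[0, 1]%classic : set R).
    by apply: sub_countable cZ; apply: subset_card_le => t _; apply: allZ.
  have := countable_lebesgue_measure0 c01.
  rewrite lebesgue_measure_itv /= lte_fin ltr01 oppr0 adde0 => /eqP.
  by rewrite eqe oner_eq0.
move/existsNP => [t /not_implyP[_ tZ]]; exists t => i.
by apply/negP => qt; apply: tZ; exists i.
Qed.

(** Polynomial dependence is recorded along real lines only, which suffices to choose the entries of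
    G one at a time. *)
Definition line_polynomial n (F : 'M[R]_n -> C) :=
  forall G H, exists q : {poly C}, forall t, F (G + t *: H) = q.[t%:C%C].

(** The entries are fixed one by one, keeping for each i some completion, depending on i, at which
    F_i does not vanish. Along the next entry each F_i at its own completion is a nonzero polynomial
    in one variable, and [real_avoid] gives a value good for all i. *)
Lemma common_nonvanishing (I : countType) n (F : I -> 'M[R]_n -> C) :
  (forall i, line_polynomial (F i)) -> (forall i, exists G, F i G != 0) ->
  exists G, forall i, F i G != 0.
Proof.
move=> lF nF; pose D (ij : 'I_n * 'I_n) : 'M[R]_n := delta_mx ij.1 ij.2.
suff H (js : seq ('I_n * 'I_n)) G0 :
    (forall i, exists c : _ -> R, F i (G0 + \sum_(j <- js) c j *: D j) != 0) ->
    exists G, forall i, F i G != 0.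
  apply: (H (enum {: 'I_n * 'I_n}) 0) => i; have [G FG] := nF i.
  exists (fun ij => G ij.1 ij.2); rewrite add0r.
  suff -> : \sum_(j <- enum {: 'I_n * 'I_n}) G j.1 j.2 *: D j = G by [].
  rewrite big_enum /= [RHS]matrix_sum_delta pair_big /=.
  by apply: eq_bigr => -[].
elim: js G0 => [|j js IH] G0 h.
  by exists G0 => i; have [c] := h i; rewrite big_nil addr0.
have {}h i : exists c : (_ -> R) * R,
    F i (G0 + c.2 *: D j + \sum_(j <- js) c.1 j *: D j) != 0.
  by have [c] := h i; rewrite big_cons addrA; exists (c, c j).
have [c hc] := choice h.
pose A i := G0 + \sum_(j <- js) (c i).1 j *: D j.
have [q hq] := choice (fun i => lF i (A i) (D j)).
have [t ht] : exists t : R, forall i, (q i).[t%:C%C] != 0.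
  apply: real_avoid => i; apply: contraNneq (hc i) => qi.
  by rewrite addrAC -/(A i) hq qi horner0.
apply: (IH (G0 + t *: D j)) => i; exists (c i).1.
by rewrite addrAC -/(A i) hq.
Qed.

Section Line.
Variables (n : nat) (L : 'M[R]_n -> 'M[C]_n).
Hypothesis LD : forall G H t, L (G + t *: H) = L G + t%:C%C *: L H.

(** A matrix over C[X] whose value at t is L(G + tH); determinant and adjugate commute with this
    evaluation. *)
Let Lpoly G H : 'M[{poly C}]_n := map_mx polyC (L G) + 'X *: map_mx polyC (L H).

Let LpolyE G H t : map_mx (horner_eval t%:C%C) (Lpoly G H) = L (G + t *: H).
Proof.
by rewrite LD; apply/matrixP => i j; rewrite !mxE /horner_eval !hornerE.
Qed.

Lemma line_polynomial_det : line_polynomial (fun G => \det (L G)).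
Proof.
by move=> G H; exists (\det (Lpoly G H)) => t; rewrite -LpolyE det_map_mx.
Qed.

Lemma line_polynomial_entry (y : 'rV[C]_n) (x : 'cV[C]_n) :
  line_polynomial (fun G => (y *m L G *m x) 0 0).
Proof.
move=> G H; exists (((y *m L G *m x) 0 0)%:P + ((y *m L H *m x) 0 0)%:P * 'X) => t.
rewrite LD mulmxDr mulmxDl -scalemxAr -scalemxAl !hornerE mxE [X in _ + X]mxE.
by rewrite mulrC.
Qed.

(** The adjugate replaces the inverse in order to remain polynomial; at an invertible L(G) they
    differ by a nonzero scalar. *)
Lemma line_polynomial_adj (y : 'rV[C]_n) (x : 'cV[C]_n) :
  line_polynomial (fun G => (y *m \adj (L G) *m x) 0 0).
Proof.
move=> G H.
exists ((map_mx polyC y *m \adj (Lpoly G H) *m map_mx polyC x) 0 0) => t.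
have -> z : z.[t%:C%C] = horner_eval t%:C%C z by [].
have -> (M : 'M[{poly C}]_1) : horner_eval t%:C%C (M 0 0) = (map_mx (horner_eval t%:C%C) M) 0 0.
  by rewrite mxE.
have hE k l (M : 'M[C]_(k, l)) : map_mx (horner_eval t%:C%C) (map_mx polyC M) = M.
  by apply/matrixP => i j; rewrite !mxE /horner_eval hornerC.
by rewrite !map_mxM map_mx_adj LpolyE !hE.
Qed.

End Line.

Lemma cmx_decomp m n (S : 'M[C]_(m, n)) :
  S = cmx (map_mx (@complex.Re R) S) + 'i%C *: cmx (map_mx (@complex.Im R) S).
Proof. by apply/matrixP => i j; rewrite !mxE -complexE. Qed.

Lemma cmx_inj m n (a b a' b' : 'M[R]_(m, n)) :
  cmx a + 'i%C *: cmx b = cmx a' + 'i%C *: cmx b' -> a = a' /\ b = b'.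
Proof.
move=> /matrixP h; split; apply/matrixP => i j; move: (h i j); rewrite !mxE;
  by move/eqP; rewrite eq_complex /=; simpc => /andP[/eqP ? /eqP ?].
Qed.

(* det (S1 + t S2) is a nonzero polynomial in t: it does not vanish at t = i. *)
Lemma real_intertwiner n (T B : 'M[R]_n) (S : 'M[C]_n) :
  S \in unitmx -> cmx T *m S = S *m cmx B -> exists S0, S0 \in unitmx /\ T *m S0 = S0 *m B.
Proof.
move=> uS; rewrite (cmx_decomp S); set S1 := map_mx _ S; set S2 := map_mx _ S.
rewrite mulmxDr mulmxDl -scalemxAr -scalemxAl -!map_mxM => /cmx_inj[TS1 TS2].
pose P : 'M[{poly R}]_n := map_mx polyC S1 + 'X *: map_mx polyC S2.
have dP : \det P != 0.
  apply: contraTneq uS => dP; rewrite unitmxE unitfE negbK.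
  have : map_poly rc (\det P) = 0 by rewrite dP rmorph0.
  rewrite -det_map_mx => /(congr1 (horner_eval 'i%C)).
  rewrite -det_map_mx /horner_eval horner0 => <-; apply/eqP; congr (\det _).
  rewrite [LHS]cmx_decomp -/S1 -/S2; apply/matrixP => i j.
  by rewrite !mxE rmorphD rmorphM /= map_polyX !map_polyC /horner_eval !hornerE.
have [t ht] := @real_avoid unit (fun=> map_poly rc (\det P)) (fun=> map_poly_neq0 _ dP).
exists (S1 + t *: S2); split; last by rewrite mulmxDr mulmxDl -scalemxAr -scalemxAl TS1 TS2.
move: (ht tt); rewrite horner_map /= fmorph_eq0 unitmxE unitfE; apply: contra_neq => h.
rewrite -[RHS]h -[_.[t]]/(horner_eval t (\det P)) -det_map_mx; congr (\det _).
apply/matrixP => i j; rewrite [LHS]mxE /= /horner_eval /= /P !mxE /=.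
by rewrite !hornerE.
Qed.

End Genericity.

Local Close Scope classical_set_scope.

(** * Generic intertwiners *)

Section GenericIntertwiner.
Variable R : realType.
Local Notation C := R[i].
Local Notation cmx := (map_mx (real_complex R)).
Local Notation rC := (ratr : rat -> C).
Local Notation rR := (ratr : rat -> R).

Lemma map_ratr_intr (K : numFieldType) m n (B : 'M[int]_(m, n)) :
  map_mx (ratr : rat -> K) (map_mx intr B) = map_mx intr B.
Proof. by apply/matrixP => i j; rewrite !mxE ratr_int. Qed.

Lemma cmx_intr m n (B : 'M[int]_(m, n)) : cmx (map_mx intr B) = map_mx intr B.
Proof. by apply/matrixP => i j; rewrite !mxE rmorph_int. Qed.

Lemma map_poly_ratr_complex (p : {poly rat}) :
  map_poly (real_complex R) (map_poly rR p) = map_poly rC p.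
Proof. by rewrite -map_poly_comp; apply: eq_map_poly => x /=; rewrite fmorph_rat. Qed.

Lemma exists_nonzero_bilin (F : fieldType) m n (y : 'rV[F]_m) (x : 'cV[F]_n) :
  y != 0 -> x != 0 -> exists i j, (y *m delta_mx i j *m x) 0 0 != 0.
Proof.
move=> /rV0Pn[i yi] /cV0Pn[j xj]; exists i, j.
rewrite -mulmxA mxE (bigD1 i) //= big1 ?addr0 => [|k ki].
  rewrite mxE (bigD1 j) //= big1 ?addr0 => [|k kj].
    by rewrite !mxE !eqxx mul1r mulf_neq0.
  by rewrite !mxE (negPf kj) andbF mul0r.
by rewrite mxE big1 ?mulr0 // => l _; rewrite !mxE (negPf ki) mul0r.
Qed.

Section Fixed.
Variables (n : nat) (fs : seq {poly rat}) (T : 'M[R]_n.+1) (B : 'M[int]_n.+1).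
Let p := \prod_(f <- fs) f.
Hypotheses (fsU : uniq fs) (fsM : all (fun f => f \is monic) fs).
Hypothesis fsI : forall f, f \in fs -> irreducible_poly f.
Let BR : 'M[R]_n.+1 := map_mx intr B.
Let BC : 'M[C]_n.+1 := map_mx intr B.
Let BQ : 'M[rat]_n.+1 := map_mx intr B.
Let pR := map_poly rR p.
Let pC := map_poly rC p.
Hypotheses (Tp : horner_mx T pR = 0) (Bp : horner_mx BQ p = 0).
Hypothesis charTB : char_poly T = char_poly BR.

Let sp : separable_poly p. Proof. exact: separable_prod_irredp. Qed.
Let spR : separable_poly pR. Proof. by rewrite separable_map. Qed.
Let spC : separable_poly pC. Proof. by rewrite separable_map. Qed.
Let BRp : horner_mx BR pR = 0.
Proof. by rewrite /BR -(map_ratr_intr R) -map_horner_mx Bp map_mx0. Qed.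
Let BCp : horner_mx BC pC = 0.
Proof. by rewrite /BC -(map_ratr_intr C) -map_horner_mx Bp map_mx0. Qed.
Let TCp : horner_mx (cmx T) pC = 0.
Proof. by rewrite /pC -map_poly_ratr_complex -map_horner_mx Tp map_mx0. Qed.

Let pC_root f l : f \in fs -> root (map_poly rC f) l -> root pC l.
Proof.
by move=> ffs fl; rewrite /pC /p (big_rem f ffs) rmorphM /= rootM fl.
Qed.

(** Over C both matrices are killed by the separable p and have the same characteristic polynomial,
    hence are similar; [real_intertwiner] brings the similarity down to the reals. *)
Lemma exists_invertible_intertwiner : exists S, S \in unitmx /\ T *m S = S *m BR.
Proof.
have [|S [uS TS]] := similar_of_char_poly spC TCp BCp.
  by rewrite -map_char_poly charTB map_char_poly cmx_intr.
by apply: (real_intertwiner uS); rewrite TS cmx_intr.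
Qed.

Let L G : 'M[C]_n.+1 := cmx (casimir pR T BR G).

Let LE G : L G = casimir pC (cmx T) BC (cmx G).
Proof. by rewrite /L map_casimir map_poly_ratr_complex cmx_intr. Qed.

Let LD G H t : L (G + t *: H) = L G + t%:C%C *: L H.
Proof. by rewrite /L casimirD map_mxD map_mxZ. Qed.

(** By [casimir_left_eigen] the scalar is a bilinear form y G w with w nonzero, and an elementary
    matrix G detects it. *)
Let left_nonvanishing (y : 'rV[C]_n.+1) l (r : 'rV[int]_n.+1) :
  root pC l -> y != 0 -> y *m cmx T = l *: y ->
  map_mx intr r *m horner_mx BC^T (pC %/ ('X - l%:P)) != 0 ->
  exists G, (y *m L G *m (map_mx intr r)^T) 0 0 != 0.
Proof.
move=> pl y0 yT r0.
have r0' : horner_mx BC (pC %/ ('X - l%:P)) *m (map_mx intr r)^T != 0.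
  by apply: contra_neq r0 => e; rewrite -horner_mx_tr -[LHS]trmxK trmx_mul trmxK e trmx0.
have [i [j ij]] := exists_nonzero_bilin y0 r0'.
exists (delta_mx i j); rewrite LE (casimir_left_eigen _ _ pl yT) map_delta_mx.
by move: ij; rewrite mulmxA; set a := (X in X 0 0 != 0 -> _); set b := (X in _ -> X 0 0 != 0);
  have -> : a = b by congr (_ *m _).
Qed.

(* Perturbing an invertible Phi0 gives an invertible intertwiner S from T back
   to B with z S x != 0, and casimir_surj realizes its inverse as some L G. *)
Let right_nonvanishing (x : 'cV[C]_n.+1) l (z : 'rV[int]_n.+1) :
  root pC l -> x != 0 -> cmx T *m x = l *: x ->
  map_mx intr z *m horner_mx BC (pC %/ ('X - l%:P)) != 0 ->
  exists G, (map_mx intr z *m \adj (L G) *m x) 0 0 != 0.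
Proof.
move=> pl x0 Tx z0.
have [i [j ij]] := exists_nonzero_bilin z0 x0.
have [S0 [uS0 TS0]] := exists_invertible_intertwiner.
pose Phi := casimir pR BR T (delta_mx i j).
have BPhi : BR *m Phi = Phi *m T by apply: casimir_intertwines.
have PhiC : cmx Phi = casimir pC BC (cmx T) (delta_mx i j).
  by rewrite map_casimir map_poly_ratr_complex cmx_intr map_delta_mx.
pose Phi0 := invmx S0.
have BPhi0 : BR *m Phi0 = Phi0 *m T.
  by rewrite -[LHS](mulKmx uS0) [S0 *m (_ *m _)]mulmxA -TS0 -mulmxA mulmxV // mulmx1.
pose zC : 'rV[C]_n.+1 := map_mx intr z.
(* [q1] is z (Phi0 + t Phi) x as a polynomial in t; its coefficient of t is nonzero by the choice of
   i and j. *)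
pose q1 : {poly C} := ((zC *m cmx Phi0 *m x) 0 0)%:P + ((zC *m cmx Phi *m x) 0 0)%:P * 'X.
have q10 : q1 != 0.
  apply/eqP => /(congr1 (fun q : {poly C} => q`_1)).
  rewrite coefD coefC coefMX coefC coef0 /= add0r => /eqP.
  by rewrite PhiC -mulmxA (casimir_right_eigen _ _ pl Tx) !mulmxA (negPf ij).
pose M2 : 'M[{poly C}]_n.+1 := map_mx polyC (cmx Phi0) + 'X *: map_mx polyC (cmx Phi).
have M2E t : map_mx (horner_eval t%:C%C) M2 = cmx (Phi0 + t *: Phi).
  by apply/matrixP => a b; rewrite !mxE /horner_eval !hornerE rmorphD rmorphM.
have q20 : \det M2 != 0.
  apply/eqP => /(congr1 (horner_eval 0%:C%C)).
  rewrite -det_map_mx M2E scale0r addr0 /horner_eval horner0 det_map_mx => /eqP.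
  by rewrite fmorph_eq0; apply/negP; rewrite -unitfE -unitmxE unitmx_inv.
have [t ht] := @real_avoid R bool (fun b => if b then q1 else \det M2)
   (fun b => if b as b return (if b then q1 else \det M2) != 0 then q10 else q20).
pose S := Phi0 + t *: Phi.
have uS : S \in unitmx.
  move: (ht false); rewrite -[_.[_]]/(horner_eval _ _) -det_map_mx M2E det_map_mx fmorph_eq0.
  by rewrite unitmxE unitfE.
have BS : BR *m S = S *m T by rewrite mulmxDr mulmxDl -scalemxAr -scalemxAl BPhi BPhi0.
have [G GE] : exists G, casimir pR T BR G = invmx S.
  apply: casimir_surj => //.
  by rewrite -[LHS](mulKmx uS) [S *m _]mulmxA -BS !mulmxA mulmxK // mulVmx // mul1mx.
exists G; rewrite -/zC.
have uL : L G \in unitmx by rewrite /L GE map_unitmx unitmx_inv.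
have -> : \adj (L G) = \det (L G) *: cmx S.
  have -> : cmx S = invmx (L G) by rewrite /L GE map_invmx invmxK.
  by rewrite /invmx uL scalerA divrr ?scale1r // -unitmxE.
rewrite -scalemxAr -scalemxAl mxE; apply: mulf_neq0; first by rewrite -unitfE -unitmxE.
clear ij.
move: (ht true); rewrite /q1 !hornerE /S map_mxD map_mxZ mulmxDr mulmxDl -scalemxAr -scalemxAl.
by move: (_ *m cmx Phi0 *m x) (_ *m cmx Phi *m x) => u v; rewrite !mxE mulrC.
Qed.

(** The families [y1] and [y2] are meant to detect parallel and perpendicular parts of lattice
    vectors, and [x] to exclude integral functionals on the perpendicular space. One G must avoid
    the zeros of det L(G) and of one function for each kind, factor and integer vector. *)
Lemma generic_intertwiner (y1 y2 : {poly rat} -> 'rV[C]_n.+1) (x : {poly rat} -> 'cV[C]_n.+1) :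
  (forall f, f \in fs -> y1 f != 0 /\ exists2 l, root (map_poly rC f) l & y1 f *m cmx T = l *: y1 f) ->
  (forall f, f \in fs -> y2 f != 0 /\ exists2 l, root (map_poly rC f) l & y2 f *m cmx T = l *: y2 f) ->
  (forall f, f \in fs -> x f != 0 /\ exists2 l, root (map_poly rC f) l & cmx T *m x f = l *: x f) ->
  exists M : 'M[R]_n.+1, [/\ M \in unitmx, T *m M = M *m BR,
    forall r : 'cV[int]_n.+1, r != 0 ->
      exists2 f, f \in fs & y1 f *m cmx (M *m map_mx intr r) != 0,
    forall r : 'cV[int]_n.+1, r != 0 ->
      exists2 f, f \in fs & y2 f *m cmx (M *m map_mx intr r) != 0 &
    forall z : 'rV[int]_n.+1, z != 0 ->
      exists2 f, f \in fs & cmx (map_mx intr z *m invmx M) *m x f != 0].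
Proof.
move=> hy1 hy2 hx.
(* Only factors that see the vector v are tested. Column vectors enter as rows acted on by the
   transpose of B, for k = 0 and 1. *)
pose valid (k : 'I_3) (f : {poly rat}) (v : 'rV[int]_n.+1) := f \in fs /\
  forall l, root (map_poly rC f) l ->
    map_mx intr v *m horner_mx (if k == ord_max then BC else BC^T) (pC %/ ('X - l%:P)) != 0.
pose F0 (k : 'I_3) f (v : 'rV[int]_n.+1) G : C :=
  if val k is 0 then (y1 f *m L G *m (map_mx intr v)^T) 0 0
  else if val k is 1 then (y2 f *m L G *m (map_mx intr v)^T) 0 0
  else (map_mx intr v *m \adj (L G) *m x f) 0 0.
(* The index [None] stands for invertibility; triples that are not valid get the harmless constant
   1. *)
pose F (i : option ('I_3 * {poly rat} * 'rV[int]_n.+1)) G : C :=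
  if i is Some (k, f, v) then (if `[< valid k f v >] then F0 k f v G else 1)
  else \det (L G).
have [||G FG] := @common_nonvanishing R _ _ F.
- case=> [[[k f] v]|]; last exact: line_polynomial_det.
  have [hv|hv] := pselect (valid k f v); last first.
    by move=> G H; exists 1 => t; rewrite hornerC /F asboolF.
  rewrite (_ : F _ = F0 k f v); last by apply/funext => G; rewrite /F asboolT.
  rewrite /F0; case: k {hv} => [[|[|m]] km] /=.
  + exact: line_polynomial_entry.
  + exact: line_polynomial_entry.
  + exact: line_polynomial_adj.
- case=> [[[k f] v]|] /=; last first.
    have [S [uS TS]] := exists_invertible_intertwiner.
    have [G GE] := casimir_surj spR BRp TS; exists G.
    by rewrite /L GE det_map_mx fmorph_eq0 -unitfE -unitmxE.
  case: asboolP => [[ffs vl]|_]; last by exists 0; rewrite oner_eq0.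
  rewrite /F0; case: k vl => [[|[|[|//]]] km] /= vl.
  + have [y0 [l fl yT]] := hy1 f ffs.
    by apply: (left_nonvanishing (pC_root ffs fl)) => //; apply: vl.
  + have [y0 [l fl yT]] := hy2 f ffs.
    by apply: (left_nonvanishing (pC_root ffs fl)) => //; apply: vl.
  + have [x0 [l fl Tx]] := hx f ffs.
    by apply: (right_nonvanishing (pC_root ffs fl)) => //; apply: vl.
pose M := casimir pR T BR G.
have uM : M \in unitmx.
  by have := FG None; rewrite /= /L det_map_mx fmorph_eq0 unitmxE unitfE.
(* Every nonzero integer vector is seen by some factor, by [rational_component]. *)
have cop (k : 'I_3) (v : 'rV[int]_n.+1) : v != 0 -> exists2 f, f \in fs & valid k f v.
  move=> v0; have v0' : map_mx intr v != 0 :> 'rV[rat]_n.+1.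
    by apply: contra_neq v0 => /matrixP e; apply/matrixP => i j; move: (e i j); rewrite !mxE => /eqP; rewrite intr_eq0 => /eqP.
  pose N := if k == ord_max then BQ else BQ^T.
  have Np : horner_mx N p = 0.
    by rewrite /N; case: ifP => // _; rewrite -horner_mx_tr Bp trmx0.
  have [f [ffs hf]] := @rational_component C n fs N _ fsU fsM fsI Np v0'.
  exists f; first exact: ffs.
  split; first exact: ffs.
  move=> l fl; move: (hf l fl).
  rewrite map_ratr_intr /N; case: ifP => _.
    by rewrite map_ratr_intr.
  by rewrite map_trmx map_ratr_intr /BC map_trmx.
exists M; split => //.
- exact: casimir_intertwines.
- move=> r r0; have [|f ffs vf] := cop ord0 r^T.
    by apply: contra_neq r0 => e; rewrite -[r]trmxK e trmx0.
  exists f => //; have := FG (Some (ord0, f, r^T)); rewrite /= asboolT // /F0 /=.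
  apply: contra_neq => e; rewrite map_trmx trmxK.
  by rewrite -(cmx_intr r) -mulmxA -map_mxM e mxE.
- have ord1' : (1 < 3)%N by []. 
  move=> r r0; have [|f ffs vf] := cop (Ordinal ord1') r^T.
    by apply: contra_neq r0 => e; rewrite -[r]trmxK e trmx0.
  exists f => //; have := FG (Some (Ordinal ord1', f, r^T)); rewrite /= asboolT // /F0 /=.
  apply: contra_neq => e; rewrite map_trmx trmxK.
  by rewrite -(cmx_intr r) -mulmxA -map_mxM e mxE.
- move=> z z0; have [f ffs vf] := cop ord_max z z0.
  exists f => //; have := FG (Some (ord_max, f, z)); rewrite /= asboolT // /F0 /=.
  apply: contra_neq => e.
  have uL : L G \in unitmx by rewrite map_unitmx.
  have -> : \adj (L G) = \det (L G) *: invmx (L G).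
    by rewrite /invmx uL scalerA divrr ?scale1r // -unitmxE.
  rewrite -scalemxAr -scalemxAl /L -map_invmx -(cmx_intr z) -map_mxM e.
  by rewrite scaler0 mxE.
Qed.

End Fixed.
End GenericIntertwiner.

(** * Contractions and Kronecker density *)

Section Contraction.
Variable R : realType.
Local Notation C := R[i].
Local Notation cpoly := (map_poly (real_complex R)).

(** The Euclidean norm does not increase; squares match the form of [unit_ball]. *)
Definition contracting n (M : 'M[R]_n) :=
  forall v : 'cV[R]_n, \sum_i (M *m v) i 0 ^+ 2 <= \sum_i v i 0 ^+ 2.

Lemma contracting_block m n (M : 'M[R]_m) (N : 'M[R]_n) :
  contracting M -> contracting N -> contracting (block_mx M 0 0 N).
Proof.
move=> cM cN v; rewrite -[v]vsubmxK mul_block_col !mul0mx addr0 add0r !big_split_ord /=.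
by apply: lerD; [under eq_bigr do rewrite col_mxEu; under [leRHS]eq_bigr do rewrite col_mxEu
  | under eq_bigr do rewrite col_mxEd; under [leRHS]eq_bigr do rewrite col_mxEd].
Qed.

(** A real z gives a 1x1 block. Otherwise the 2x2 matrix of multiplication by z scales norms by |z|,
    and its characteristic polynomial (X - z)(X - conj z) divides every real polynomial vanishing at
    z. *)
Lemma exists_contraction_root (z : C) : `|z| <= 1 -> exists n (M : 'M[R]_n.+1),
  contracting M /\ forall w : {poly R}, root (cpoly w) z -> char_poly M %| w.
Proof.
case: z => a b; rewrite normc_def -(rmorph1 (real_complex R)) lecR /= => ab.
have {}ab : a ^+ 2 + b ^+ 2 <= 1.
  by rewrite -ler_sqrt // sqrtr1.
have [b0|b0] := eqVneq b 0.
  exists 0%N, (a%:M); split.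
    move=> v; rewrite !big_ord1 mul_scalar_mx mxE exprMn.
    by apply: ler_piMl; [exact: sqr_ge0|move: ab; rewrite b0; lra].
  move=> w wz; rewrite /char_poly /char_poly_mx det_mx11 !mxE eqxx mulr1n dvdp_XsubCl.
  by move: wz; rewrite b0 complexr0 fmorph_root.
pose N : 'M[R]_2 := \matrix_(i, j) if i == j then a else if (i < j)%N then - b else b.
exists 1%N, N; split.
  move=> v; rewrite !big_ord_recl !big_ord0 !mxE !big_ord_recl !big_ord0 !mxE /= !addr0.
  move: (v _ 0) (v _ 0) => x y.
  have -> : (a * y + - b * x) ^+ 2 + (b * y + a * x) ^+ 2 = (a ^+ 2 + b ^+ 2) * (y ^+ 2 + x ^+ 2) by ring.
  by apply: ler_piMl => //; apply: addr_ge0; exact: sqr_ge0.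
move=> w wz.
have cE : cpoly (char_poly N) = ('X - (a +i* b)%C%:P) * ('X - (a -i* b)%C%:P).
  rewrite /char_poly (expand_det_row _ 0) !big_ord_recl big_ord0 /cofactor !det_mx11 !mxE /=.
  have -> : (a +i* b)%C = a%:C%C + 'i%C * b%:C%C by rewrite [LHS]complexE.
  have -> : (a -i* b)%C = a%:C%C - 'i%C * b%:C%C by rewrite [LHS]complexE /= rmorphN mulrN.
  have I2 : 'i%C%:P * 'i%C%:P = -1 :> {poly C}.
    by rewrite -polyCM -expr2 sqr_i polyCN.
  rewrite !(mulr1n, mulr0n) !(rmorphD, rmorphB, rmorphN, rmorphM, rmorph1, rmorph0) /=.
  rewrite !map_polyX !map_polyC /=.
  move: (a%:C%C%:P) (b%:C%C%:P) 'X => u v x.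
  transitivity ((x - u) ^+ 2 - 'i%C%:P * 'i%C%:P * v ^+ 2); last by ring.
  by rewrite I2; ring.
rewrite -(dvdp_map (real_complex R)) cE Gauss_dvdp.
  rewrite !dvdp_XsubCl wz /=.
  have := complex_root_conj (cpoly w) (a -i* b)%C.
  rewrite /= opprK wz -map_poly_comp (eq_map_poly (g := real_complex R)) => [-> //|].
  by move=> x /=; rewrite oppr0.
rewrite coprimep_XsubC root_XsubC eq_complex /= eqxx /=.
by apply: contra b0 => /eqP h; apply/eqP; lra.
Qed.

(** One block is split off for a root of q, and induction treats the quotient; the characteristic
    polynomial of the block divides both p and q. *)
Lemma exists_contraction (p q : {poly R}) :
  q \is monic -> (1 < size q)%N ->
  (forall z : C, root (cpoly q) z -> `|z| <= 1 /\ root (cpoly p) z) ->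
  exists n (M : 'M[R]_n.+1), [/\ char_poly M = q, horner_mx M p = 0 & contracting M].
Proof.
have [n] := ubnP (size q); elim: n q => // n IH q sq qm q1 hq.
have /closed_rootP[z qz] : size (cpoly q) != 1%N by rewrite size_map_poly gtn_eqF.
have [z1 pz] := hq z qz.
have [m [M [cM hM]]] := exists_contraction_root z1.
have Mp : horner_mx M p = 0.
  by have /dvdpP[u ->] := hM p pz; rewrite rmorphM /= Cayley_Hamilton mulr0.
have /dvdpP[r qE] := hM q qz.
have Mm : char_poly M \is monic by exact: char_poly_monic.
have rm : r \is monic by move: qm; rewrite qE monicMr.
have sr : size q = (size r + m.+1)%N.
  by rewrite qE size_Mmonic ?monic_neq0 // size_char_poly addnS.
have r0 : (0 < size r)%N by rewrite size_poly_gt0 monic_neq0.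
have [r1|r1] := leqP (size r) 1.
  exists m, M; split => //.
  rewrite qE; have -> : r = 1; last by rewrite mul1r.
  by move: rm; rewrite [r]size1_polyC // monicE lead_coefC => /eqP ->.
have [||m' [N [NE Np cN]]] := IH r _ rm r1.
- by move: sq; rewrite sr; move: (size r) => a; lia.
- by move=> w rw; apply: hq; rewrite qE rmorphM rootM /= rw.
exists (m + m'.+1)%N, (block_mx M 0 0 N); split.
- by rewrite (@char_poly_block _ m.+1 m'.+1) NE qE mulrC.
- by rewrite horner_mx_block Mp Np; exact: (@block_mx_const _ m.+1 m'.+1 m.+1 m'.+1 0).
- exact: (@contracting_block m.+1 m'.+1).
Qed.
End Contraction.

(** * Kronecker's density theorem *)

Lemma int_simultaneous_multiple (K : numFieldType) m s (W : 'M[K]_(m, s)) :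
  (forall j, exists k (a : 'cV[int]_m), (0 < k)%N /\ forall i, k%:R * W i j = (a i 0)%:~R) ->
  exists N (Z : 'M[int]_(m, s)), (0 < N)%N /\ N%:R *: W = map_mx intr Z.
Proof.
move=> h; have [k hk] := choice h; have [a ha] := choice hk.
pose N := (\prod_j k j)%N.
exists N, (\matrix_(i, j) ((\prod_(l | l != j) k l)%N%:Z * a j i 0)); split.
  by apply: prodn_gt0 => j; case: (ha j).
apply/matrixP => i j; rewrite !mxE rmorphM /= -(ha j).2 /N (bigD1 j) //=.
by rewrite mulnC natrM -mulrA -pmulrn.
Qed.

Section Density.
Variable R : realType.

(** Pigeonhole: among (Q + 1)^m + 1 multiples of w, two have fractional parts in the same box of
    side 1 / (Q + 1); their difference gives k and a. *)
Lemma dirichlet m (w : 'cV[R]_m) (Q : nat) :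
  exists k (a : 'cV[int]_m), (0 < k)%N /\
    forall i, `|k%:R * w i 0 - (a i 0)%:~R| * Q.+1%:R < 1.
Proof.
pose fr (x : R) := x - (Num.floor x)%:~R.
have fr0 x : 0 <= fr x by rewrite subr_ge0 Num.Theory.floor_le.
have fr1 x : fr x < 1 by rewrite ltrBlDl; have := floorD1_gt x; rewrite rmorphD.
pose T := {ffun 'I_m -> 'I_Q.+1}.
pose c (x : R) : 'I_Q.+1 := inord (absz (Num.floor (fr x * Q.+1%:R))).
pose f (k : 'I_#|T|.+1) : T := [ffun i => c (k%:R * w i 0)].
have cE x y : c x = c y -> `|fr x - fr y| * Q.+1%:R < 1.
  have X0 z : 0 <= fr z * Q.+1%:R by rewrite mulr_ge0.
  have XQ z : (absz (Num.floor (fr z * Q.+1%:R)) < Q.+1)%N.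
    have : Num.floor (fr z * Q.+1%:R) < Q.+1%:Z.
      by rewrite floor_lt_int -pmulrn -[ltRHS]mul1r ltr_pM2r.
    by have := X0 z; rewrite -floor_ge0; move: (Num.floor _) => t; lia.
  move=> /(congr1 val); rewrite /c /= !inordK // => e.
  have fe : Num.floor (fr x * Q.+1%:R) = Num.floor (fr y * Q.+1%:R).
    have F0 z : 0 <= Num.floor (fr z * Q.+1%:R) by rewrite floor_ge0.
    move: (F0 x) (F0 y) e.
    by move: (Num.floor _) (Num.floor _) => t u; lia.
  rewrite -[Q.+1%:R]ger0_norm // -normrM mulrBl.
  have /andP[x1 x2] := floor_itv (fr x * Q.+1%:R).
  have /andP[y1 y2] := floor_itv (fr y * Q.+1%:R).
  by move: x1 x2 y1 y2; rewrite fe rmorphD /= ltr_norml; lra.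
have [|k [l [kl fkl]]] := @pigeonhole _ _ f; first by rewrite card_ord.
wlog lt : k l kl fkl / (k < l)%N.
  move=> h; have [lt|lt|/val_inj e] := ltngtP k l; first exact: h lt.
    by apply: (h l k); rewrite 1?eq_sym.
  by rewrite e eqxx in kl.
exists (l - k)%N, (\col_i (Num.floor (l%:R * w i 0) - Num.floor (k%:R * w i 0))); split.
  by rewrite subn_gt0.
move=> i; rewrite mxE rmorphB /= natrB ?(ltnW lt) //.
have -> : (l%:R - k%:R) * w i 0 - ((Num.floor (l%:R * w i 0))%:~R - (Num.floor (k%:R * w i 0))%:~R)
  = fr (l%:R * w i 0) - fr (k%:R * w i 0) by rewrite /fr; ring.
by apply: cE; move/ffunP: fkl => /(_ i); rewrite !ffunE.
Qed.

(** Kronecker's criterion: a nonzero functional taking integer values on U Z^s is the obstruction to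
    density. *)
Definition no_integral_functional m s (U : 'M[R]_(m, s)) :=
  forall (xi : 'rV[R]_m) (z : 'rV[int]_s), xi *m U = map_mx intr z -> xi = 0.

(** Otherwise the only short vector of U Z^s is 0. With V made of independent columns of U,
    Dirichlet approximation of a column of V^-1 U yields a short vector, hence an equality, so V^-1
    U is rational. A multiple of a row of V^-1 is then a forbidden functional. *)
Lemma small_lattice_vector m s (U : 'M[R]_(m.+1, s)) e :
  no_integral_functional U -> 0 < e ->
  exists r : 'cV[int]_s, U *m map_mx intr r != 0 /\
    forall i, `|(U *m map_mx intr r) i 0| < e.
Proof.
move=> hU e0; apply: contrapT => /forallNP hr.
have {}hr (r : 'cV[int]_s) : (forall i, `|(U *m map_mx intr r) i 0| < e) -> U *m map_mx intr r = 0.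
  by move=> small; apply: contrapT => /eqP nz; apply: (hr r).
have fU : row_full U^T.
  rewrite /row_full mxrank_tr -/(row_free U) -kermx_eq0.
  by apply/rowV0P => xi /sub_kermxP h; apply: (hU _ 0); rewrite h map_mx0.
pose f := fullrankfun fU.
pose V := (rowsub f U^T)^T.
have uV : V \in unitmx by rewrite unitmx_tr; exact: fullrowsub_unit.
have VE (a : 'cV[int]_m.+1) : V *m map_mx intr a =
    U *m map_mx intr (\sum_i a i 0 *: delta_mx (f i) 0 : 'cV[int]_s).
  rewrite raddf_sum mulmx_sumr /= [map_mx intr a]matrix_sum_delta mulmx_sumr.
  apply: eq_bigr => i _; rewrite big_ord1 -scalemxAr map_mxZ map_delta_mx -scalemxAr mxE.
  congr (_ *: _); rewrite -!colE; apply/colP => k; by rewrite !mxE.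
pose c : R := \sum_i \sum_j `|V i j|.
have c0 : 0 <= c by apply: sumr_ge0 => *; apply: sumr_ge0.
(* Makes c / (Q + 1) < e, so that V sends the approximation error to a vector with entries below
   e. *)
have [Q hQ] : exists Q, c < e * Q.+1%:R.
  exists (Num.bound (c / e)); rewrite -ltr_pdivrMl // mulrC.
  apply: lt_trans (archi_boundP _) _; first by rewrite divr_ge0 // ltW.
  by rewrite ltr_nat.
have [N [Z [N0 NZ]]] : exists N (Z : 'M[int]_(m.+1, s)), (0 < N)%N /\
    N%:R *: (invmx V *m U) = map_mx intr Z.
  apply: int_simultaneous_multiple => j.
  have [k [a [k0 ha]]] := dirichlet (col j (invmx V *m U)) Q.
  exists k, a; split => // i.
  pose w : 'cV[R]_m.+1 := k%:R *: col j (invmx V *m U) - map_mx intr a.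
  have Vw : V *m w = U *m map_mx intr (k%:Z *: delta_mx j 0 -
      \sum_i a i 0 *: delta_mx (f i) 0 : 'cV[int]_s).
    rewrite /w map_mxB !mulmxBr -VE; congr (_ - _).
    have -> : map_mx intr (k%:Z *: delta_mx j 0 : 'cV[int]_s) = k%:R *: delta_mx j 0 :> 'cV[R]_s.
      by apply/matrixP => a1 a2; rewrite !mxE; case: (_ && _); rewrite ?mulr1 ?mulr0.
    rewrite -!scalemxAr; congr (_ *: _).
    by rewrite colE !mulmxA mulmxV // mul1mx.
  have w0 : w = 0.
    rewrite -[w](mulKmx uV) Vw hr ?mulmx0 // => l; rewrite -Vw mxE.
    have Q0 : 0 < Q.+1%:R :> R by rewrite ltr0n.
    rewrite -(ltr_pM2r Q0); apply: le_lt_trans hQ.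
    apply: le_trans (ler_wpM2r (ltW Q0) (ler_norm_sum _ _ _)) _.
    rewrite mulr_suml.
    apply: (@le_trans _ _ (\sum_j0 `|V l j0|)).
      apply: ler_sum => b _; rewrite normrM -mulrA ler_piMr //.
      by have := ha b; rewrite !mxE => /ltW.
    by rewrite /c [leRHS](bigD1 l) //= lerDl; apply: sumr_ge0 => *; apply: sumr_ge0.
  by have /colP/(_ i) := w0; rewrite !mxE => /eqP; rewrite subr_eq0 => /eqP.
have : N%:R *: row 0 (invmx V) = 0.
  apply: (hU _ (row 0 Z)); rewrite map_row -NZ -scalemxAl -row_mul.
  by apply/rowP => j; rewrite !mxE.
move/(congr1 (fun x => (x *m V) 0 0)).
rewrite -scalemxAl -row_mul mulVmx // mul0mx !mxE eqxx mulr1 => /eqP.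
by rewrite pnatr_eq0 => /eqP NN; rewrite NN in N0.
Qed.

(* Induction on m: project along a lattice image h with entries below e / 2,
   approximate in the quotient, then correct by a multiple of h. *)
Lemma kronecker_density m s (U : 'M[R]_(m, s)) :
  no_integral_functional U -> forall (x : 'cV[R]_m) e, 0 < e ->
  exists r : 'cV[int]_s, forall i, `|(U *m map_mx intr r - x) i 0| < e.
Proof.
elim: m U => [|m IH] U hU x e e0; first by exists 0 => -[].
have e20 : 0 < e / 2 by rewrite divr_gt0.
have [rh [h0 hsmall]] := small_lattice_vector hU e20.
set h := U *m _ in h0 hsmall.
have /cV0Pn[i0 hi0] := h0.
(* Projection along h onto the coordinates other than i0. *)
pose W : 'M[R]_(m, m.+1) := \matrix_(j, i)
  ((i == lift i0 j)%:R - h (lift i0 j) 0 / h i0 0 * (i == i0)%:R).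
have WE (v : 'cV[R]_m.+1) j : (W *m v) j 0 =
    v (lift i0 j) 0 - h (lift i0 j) 0 / h i0 0 * v i0 0.
  rewrite mxE; under eq_bigr do rewrite mxE mulrBl.
  rewrite sumrB (bigD1 (lift i0 j)) //= eqxx mul1r big1 ?addr0; last first.
    by move=> i /negPf ->; rewrite mul0r.
  rewrite (bigD1 i0) //= eqxx mulr1 [X in _ - (_ + X)]big1 ?addr0 //.
  by move=> i /negPf ->; rewrite mulr0 mul0r.
have hWU : no_integral_functional (W *m U).
  move=> xi z; rewrite mulmxA => /hU /rowP xiW; apply/rowP => j.
  have := xiW (lift i0 j); rewrite !mxE (bigD1 j) //= big1 ?addr0.
    by rewrite !mxE eqxx eq_sym (negPf (neq_lift _ _)) mulr0 subr0 mulr1.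
  move=> k kj; rewrite !mxE (inj_eq (@lift_inj _ _)) eq_sym (negPf kj).
  by rewrite eq_sym (negPf (neq_lift _ _)) mulr0 subr0 mulr0.
have [r hr] := IH (W *m U) hWU (W *m x) _ e20.
pose v := U *m map_mx intr r - x.
(* Subtracting floor(t) h leaves a fractional multiple of h in coordinate i0 and changes nothing
   after projection by W. *)
pose t := v i0 0 / h i0 0.
exists (r - Num.floor t *: rh) => i.
have -> : U *m map_mx intr (r - Num.floor t *: rh) - x = v - (Num.floor t)%:~R *: h.
  by rewrite map_mxB map_mxZ mulmxBr -scalemxAr addrAC.
pose fr := t - (Num.floor t)%:~R.
have fr01 : `|fr| <= 1.
  have /andP[t1 t2] := floor_itv t; rewrite rmorphD /= in t2.
  by rewrite /fr ler_norml; apply/andP; split; lra.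
have frh k : `|fr * h k 0| < e / 2.
  by rewrite normrM; apply: le_lt_trans (hsmall k); apply: ler_piMl.
have [j ->|->] := unliftP i0 i; last first.
  rewrite mxE [X in _ + X]mxE [X in _ - X]mxE.
  have -> : v i0 0 - (Num.floor t)%:~R * h i0 0 = fr * h i0 0.
    by rewrite /fr mulrBl /t divfK.
  by apply: lt_trans (frh i0) _; rewrite ltr_pdivrMr // ltr_pMr // ltr1n.
rewrite mxE [X in _ + X]mxE [X in _ - X]mxE.
have -> : v (lift i0 j) 0 - (Num.floor t)%:~R * h (lift i0 j) 0 =
   (W *m v) j 0 + fr * h (lift i0 j) 0.
  by rewrite WE /fr /t; field.
have : `|(W *m v) j 0| < e / 2 by rewrite mulmxBr mulmxA.
have := frh (lift i0 j).
move=> a1 a2; apply: le_lt_trans (ler_normD _ _) _; lra.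
Qed.
End Density.

(** * The integer matrix induced on the lattice *)

Local Open Scope classical_set_scope.
Local Open Scope ring_scope.

(** * Extremal multiplicities among the roots of a factor *)

Section Multiplicities.
Variables (R : realType) (n : nat) (A : 'M[R]_n.+1).
Local Notation C := R[i].
Implicit Type f : {poly rat}.

Lemma mup_le_size (F : fieldType) (q : {poly F}) z : q != 0 -> (mup z q < size q)%N.
Proof.
move=> q0; have : ('X - z%:P) ^+ mup z q %| q by rewrite -mup_geq.
by move/(dvdp_leq q0); rewrite size_exp_XsubC.
Qed.

Lemma mA_lt l : (mA A l < n.+2)%N.
Proof.
have := mup_le_size l (monic_neq0 (char_poly_monic (Cmx A))).
by rewrite size_char_poly.
Qed.

Lemma Mmax_ge f l : root (map_poly ratr f) l -> (mA A l <= Mmax A f)%N.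
Proof.
move=> fl; rewrite /Mmax (bigD1 (Ordinal (mA_lt l))) /=; first exact: leq_maxl.
by apply/asboolP; exists l.
Qed.

Lemma Mmax_le f k : (forall l : C, root (map_poly ratr f) l -> (mA A l <= k)%N) -> (Mmax A f <= k)%N.
Proof.
by move=> h; apply/bigmax_leqP => i /asboolP[l [fl <-]]; apply: h.
Qed.

Lemma Mmin_le f l : root (map_poly ratr f) l -> (Mmin A f <= mA A l)%N.
Proof.
move=> fl; pose i := Ordinal (mA_lt l).
have Pi : `[< exists l' : C, root (map_poly ratr f) l' /\ mA A l' = i >].
  by apply/asboolP; exists l.
rewrite /Mmin -[X in (_ <= X)%N]/(nat_of_ord i).
have := mem_index_enum i; elim: (index_enum _) => // j r IH.
rewrite inE big_cons => /orP[/eqP <-|/IH le]; first by rewrite Pi geq_minl.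
by case: ifP => // _; apply: leq_trans le; apply: geq_minr.
Qed.

(** The bound on k accounts for [n.+1], the initial value of the iterated minimum. *)
Lemma Mmin_ge f k : (k <= n.+1)%N ->
  (forall l : C, root (map_poly ratr f) l -> (k <= mA A l)%N) -> (k <= Mmin A f)%N.
Proof.
move=> kn h; rewrite /Mmin; elim/big_ind: _ => // [x y kx ky|i /asboolP[l [fl <-]]].
  by rewrite leq_min kx ky.
exact: h.
Qed.

Lemma Mmax_bound f : (Mmax A f <= n.+1)%N.
Proof. by apply: Mmax_le => l _; rewrite -ltnS mA_lt. Qed.

End Multiplicities.

Section LowerBound.
Variable R : realType.
Local Notation C := R[i].

Lemma dense_approx m (D : set 'cV[R]_m) (x : 'cV[R]_m) e : dense D -> 0 < e ->
  exists2 y, D y & forall i, `|(y - x) i 0| < e.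
Proof.
move=> dD e0; have [||y [xy Dy]] := dD ((ball x e)^°).
- by exists x; exact: nbhsx_ballx.
- exact: open_interior.
exists y => // i; have [_ /(_ i 0)] := interior_subset xy.
by rewrite !mxE -ball_normE /= distrC.
Qed.

Lemma approx_dense m (D : set 'cV[R]_m) :
  (forall x e, 0 < e -> exists2 y, D y & forall i, `|(y - x) i 0| < e) -> dense D.
Proof.
move=> h O [x Ox] oO; have /nbhs_ballP[e e0 eO] : nbhs x O by apply: open_nbhs_nbhs.
have [y Dy xy] := h x e e0; exists y; split => //; apply: eO; split => // i j.
by rewrite ord1 -ball_normE /= distrC; have := xy i; rewrite !mxE.
Qed.

Lemma bounded_set_entries m (D : set 'cV[R]_m) : bounded_set D ->
  exists K, forall x, D x -> forall i, `|x i 0| <= K.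
Proof.
case=> M [_ hM]; exists (M + 1) => x Dx i.
have := hM (M + 1) _ x Dx; rewrite ltrDl ltr01 => /(_ isT); apply: le_trans.
have -> : `|x| = mx_norm x by [].
by rewrite mx_normrE; exact: (le_bigmax _ (fun ij => `|x ij.1 ij.2|) (i, 0)).
Qed.

Lemma window_ball m (Om : set 'cV[R]_m) : window Om ->
  exists (c : 'cV[R]_m) e, 0 < e /\ forall x, (forall i, `|(x - c) i 0| < e) -> Om x.
Proof.
case=> _ cl [y cy]; have [c Ic] : interior Om !=set0.
  apply: contrapT => /set0P/negP; rewrite negbK => /eqP I0.
  by move: cy; rewrite -cl I0 closure0.
have /nbhs_ballP[e e0 eO] := Ic.
exists c, e; split => // x h; apply: eO; split => // i j.
by rewrite ord1 -ball_normE /= distrC; have := h i; rewrite !mxE.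
Qed.

Lemma mulmx_entry_le m s (U : 'M[R]_(m, s)) (v : 'cV[R]_s) b :
  (forall j, `|v j 0| <= b) -> forall i, `|(U *m v) i 0| <= (\sum_i \sum_j `|U i j|) * b.
Proof.
move=> hv i; rewrite mxE; apply: le_trans (ler_norm_sum _ _ _) _.
apply: (@le_trans _ _ ((\sum_j `|U i j|) * b)).
  by rewrite mulr_suml; apply: ler_sum => j _; rewrite normrM ler_wpM2l.
(* For s = 0 the bound b may be negative, but both sides vanish. *)
have [s0|s0] := posnP s.
  move: U v hv; rewrite s0 => U v hv; rewrite big_ord0 mul0r.
  by rewrite big1 ?mul0r // => k _; rewrite big_ord0.
have b0 : 0 <= b by apply: le_trans (hv (Ordinal s0)).
apply: ler_wpM2r => //; rewrite [leRHS](bigD1 i) //= lerDl.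
by apply: sumr_ge0 => *; apply: sumr_ge0.
Qed.

Section Scheme.
Variables (n m : nat) (A : 'M[R]_n) (L : 'M[R]_(n + m)) (Om : set 'cV[R]_m).
Hypotheses (gL : generic_cps L) (wOm : window Om).
Hypothesis AOm : forall x, cp_set L Om x -> cp_set L Om (A *m x).
Let X := usubmx L.
Let U := dsubmx L.
Local Notation int_r r := (map_mx (intr : int -> R) r).
Local Notation small y e := (forall i, `|y i 0| <= e).

Let XE (v : 'cV[R]_(n + m)) : ppar (L *m v) = X *m v.
Proof. by rewrite /ppar /X mul_usub_mx. Qed.
Let UE (v : 'cV[R]_(n + m)) : pperp (L *m v) = U *m v.
Proof. by rewrite /pperp /U mul_dsub_mx. Qed.

Let latticeP (r : 'cV[int]_(n + m)) : lattice L (L *m int_r r). Proof. by exists r. Qed.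

Let int_rZ (k : nat) (r : 'cV[int]_(n + m)) : int_r (k%:Z *: r) = k%:R *: int_r r.
Proof. by rewrite map_mxZ. Qed.

Let U_dense x e : 0 < e -> exists r : 'cV[int]_(n + m), small (U *m int_r r - x) e.
Proof.
move=> e0; have [_ _ _ dL] := gL.
have [_ [_ [r _ <-] <-] h] := dense_approx x dL e0.
by exists r => i; apply/ltW; rewrite -UE; apply: h.
Qed.

Let step (r : 'cV[int]_(n + m)) : Om (U *m int_r r) -> exists2 r' : 'cV[int]_(n + m), X *m int_r r' = A *m (X *m int_r r) & Om (U *m int_r r').
Proof.
move=> Or; have [|_ [[r' _ <-] O'] e] := AOm (x := X *m int_r r).
  by exists (L *m int_r r); rewrite ?XE //; split => //; rewrite UE.
by exists r'; [rewrite -XE | rewrite -UE].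
Qed.

(* Any two lattice points over a small ball in the window differ by a lattice
   point with small pperp; subtracting their images controls A on the latter. *)
Let step_small : exists e K, 0 < e /\ forall r : 'cV[int]_(n + m), small (U *m int_r r) e ->
  exists2 r' : 'cV[int]_(n + m), X *m int_r r' = A *m (X *m int_r r) & small (U *m int_r r') K.
Proof.
have [K hK] := bounded_set_entries (let: And3 b _ _ := wOm in b).
have [c [e [e0 hc]]] := window_ball wOm.
exists (e / 4), (K + K); split; first by rewrite divr_gt0.
move=> r hr; have [r0 hr0] := U_dense c (divr_gt0 e0 (ltr0n R 4)).
have [|r0' X0 O0] := @step r0.
  by apply: hc => i; apply: le_lt_trans (hr0 i) _; lra.
have [|r1' X1 O1] := @step (r0 + r).
  apply: hc => i; rewrite map_mxD mulmxDr addrAC mxE.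
  apply: le_lt_trans (ler_normD _ _) _.
  by have := hr0 i; have := hr i; move: e0; set a := `|_|; set b := `|_|; lra.
exists (r1' - r0').
  by rewrite map_mxB mulmxBr X0 X1 map_mxD !mulmxDr addrAC subrr add0r.
move=> i; rewrite map_mxB mulmxBr mxE [X in _ + X]mxE; apply: le_trans (ler_normB _ _) _.
by apply: lerD; apply: hK.
Qed.

(** With N + 1 large, r = (N + 1) r1 + r2, where density puts the perpendicular part of r1 near 1 /
    (N + 1) of that of r. Both pieces are then small enough for [step_small]. *)
Let step_bounded b : exists K, forall r : 'cV[int]_(n + m), small (U *m int_r r) b ->
  exists2 r' : 'cV[int]_(n + m), X *m int_r r' = A *m (X *m int_r r) & small (U *m int_r r') K.
Proof.
have [e [K [e0 hK]]] := step_small.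
pose N := Num.bound (2 * `|b| / e).
have bN : `|b| / N.+1%:R <= e / 2.
  have N0 : 0 < N.+1%:R :> R by rewrite ltr0n.
  rewrite ler_pdivrMr // mulrAC ler_pdivlMr // mulrC.
  have : 2 * `|b| / e < N.+1%:R.
    apply: (lt_le_trans (archi_boundP _)); last by rewrite ler_nat.
    by rewrite divr_ge0 ?mulr_ge0 // ltW.
  by rewrite ltr_pdivrMr // mulrC => /ltW; rewrite mulrC [e * _]mulrC.
exists (N.+1%:R * K + K) => r hr.
have e20 : 0 < e / 2 / N.+1%:R by rewrite !divr_gt0 // ltr0n.
have N1 : 1 <= N.+1%:R :> R by rewrite ler1n.
have [r1 hr1] := U_dense (N.+1%:R^-1 *: (U *m int_r r)) e20.
pose r2 := r - N.+1%:Z *: r1.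
have r2E : U *m int_r r2 = - (N.+1%:R *: (U *m int_r r1 - N.+1%:R^-1 *: (U *m int_r r))).
  rewrite scalerBr scalerA divff ?pnatr_eq0 // scale1r opprB.
  by rewrite map_mxB int_rZ mulmxBr -scalemxAr.
have [|r1' X1 S1] := hK r1.
  move=> i; have := hr1 i; rewrite mxE [X in _ + X]mxE [X in _ - X]mxE => h.
  rewrite -[(U *m _) i 0](subrK (N.+1%:R^-1 * (U *m int_r r) i 0)).
  apply: le_trans (ler_normD _ _) _; rewrite normrM normfV [`|N.+1%:R|]ger0_norm //.
  have h1 : N.+1%:R^-1 * `|(U *m int_r r) i 0| <= e / 2.
    apply: le_trans bN; rewrite mulrC ler_wpM2r ?invr_ge0 //.
    by apply: le_trans (hr i) (ler_norm _).
  have h2 : e / 2 / N.+1%:R <= e / 2.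
    by rewrite ler_pdivrMr ?ltr0n // ler_peMr // divr_ge0 // ltW.
  by rewrite [leRHS](splitr e); apply: lerD h1; apply: le_trans h h2.
have [|r2' X2 S2] := hK r2.
  move=> i; rewrite r2E mxE normrN mxE normrM [`|N.+1%:R|]ger0_norm //.
  apply: (@le_trans _ _ (N.+1%:R * (e / 2 / N.+1%:R))); first by rewrite ler_wpM2l.
  by rewrite mulrC divfK ?pnatr_eq0 //; lra.
exists (N.+1%:Z *: r1' + r2').
  rewrite map_mxD int_rZ mulmxDr -scalemxAr X1 X2 /r2 map_mxB int_rZ !mulmxBr -!scalemxAr.
  by rewrite addrC subrK.
move=> i; rewrite map_mxD int_rZ mulmxDr -scalemxAr mxE; apply: le_trans (ler_normD _ _) _.
apply: lerD => //; rewrite mxE normrM ger0_norm //.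
by rewrite ler_wpM2l.
Qed.

Let exists_int_action : exists B : 'M[int]_(n + m), X *m int_r B = A *m X.
Proof.
have h j : exists c : 'cV[int]_(n + m), X *m int_r c = A *m (X *m int_r (delta_mx j 0)).
  have [K hK] := step_bounded ((\sum_i \sum_j `|U i j|) * 1).
  have [|r' e _] := hK (delta_mx j 0); last by exists r'.
  apply: mulmx_entry_le => k; rewrite !mxE; case: (_ && _); rewrite ?normr1 ?normr0 //.
have [c hc] := choice h; exists (\matrix_(i, j) c j i 0).
apply/matrixP => i j; have /matrixP/(_ i 0) := hc j.
rewrite map_delta_mx mulmxA -colE [X in _ = X -> _]mxE => <-.
by rewrite !mxE; apply: eq_bigr => k _; rewrite !mxE.
Qed.

(** B comes from the images of the basis vectors. For T, U B must vanish on the real kernel of U: if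
    U v = 0, rounding t v gives an integer vector r with U r bounded, so U B r is bounded and t |U B
    v| is bounded for all t. *)
Lemma cps_integral_model : exists (B : 'M[int]_(n + m)) (T : 'M[R]_m),
  block_mx A 0 0 T *m L = L *m int_r B.
Proof.
have [uL injX _ _] := gL; have [B XB] := exists_int_action.
suff : (U *m int_r B <= U)%MS.
  case/submxP => T UB; exists B, T.
  rewrite -[L]vsubmxK -/X -/U mul_block_col mul_col_mx XB UB.
  by rewrite !mul0mx addr0 add0r.
(* Injectivity of the parallel projection identifies B r with the vector supplied by
   [step_bounded]. *)
have KB b : exists K, forall r : 'cV[int]_(n + m), small (U *m int_r r) b -> small (U *m int_r B *m int_r r) K.
  have [K hK] := step_bounded b; exists K => r /hK[r' e S]; rewrite -mulmxA -map_mxM.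
  suff -> : B *m r = r' by [].
  have : int_r (B *m r) = int_r r'.
    apply: (can_inj (mulKmx uL)); apply: injX; [exact: latticeP|exact: latticeP|].
    by rewrite !XE e map_mxM !mulmxA XB.
  by move/matrixP => h; apply/matrixP => i j; move: (h i j); rewrite !mxE => /intr_inj.
rewrite submxE; apply/eqP/matrixP => i j; rewrite [RHS]mxE.
have [v Uv ->] : exists2 v : 'cV[R]_(n + m), U *m v = 0 &
    (U *m int_r B *m cokermx U) i j = (U *m int_r B *m v) i 0.
  exists (col j (cokermx U)); first by rewrite colE mulmxA mulmx_coker mul0mx.
  have -> : U *m int_r B *m col j (cokermx U) = col j (U *m int_r B *m cokermx U).
    by rewrite !colE !mulmxA.
  by rewrite [in RHS]/col mxE.
have [K hK] := KB ((\sum_i \sum_j `|U i j|) * 1).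
set W := U *m int_r B in hK *.
pose c := \sum_i \sum_j `|W i j|.
have bd (t : nat) : t%:R * `|(W *m v) i 0| <= K + c * 1.
  pose r : 'cV[int]_(n + m) := \col_k Num.floor (t%:R * v k 0).
  have rv k : `|(int_r r - t%:R *: v) k 0| <= 1.
    rewrite !mxE; have /andP[] := floor_itv (t%:R * v k 0).
    by rewrite rmorphD /= ler_norml => *; apply/andP; split; lra.
  have Ur : small (U *m int_r r) ((\sum_i \sum_j `|U i j|) * 1).
    have -> : U *m int_r r = U *m (int_r r - t%:R *: v).
      by rewrite mulmxBr -scalemxAr Uv scaler0 subr0.
    exact: mulmx_entry_le.
  have := hK r Ur i; have := mulmx_entry_le W rv i.
  rewrite mulmxBr -scalemxAr => h1 h2.
  rewrite -[t%:R]ger0_norm // -normrM.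
  have -> : t%:R * (W *m v) i 0 = (W *m int_r r) i 0 - (W *m int_r r - t%:R *: (W *m v)) i 0.
    by move: (W *m int_r r) (W *m v) => a b; rewrite !mxE opprB addrC subrK.
  apply: le_trans (ler_normB _ _) _; exact: lerD.
apply/eqP; rewrite -normr_eq0 eq_le normr_ge0 andbT leNgt; apply/negP => pos.
have := bd (Num.bound ((K + c * 1) / `|(W *m v) i 0|)).
apply/negP; rewrite -ltNge -ltr_pdivrMr //; apply: archi_boundP.
rewrite divr_ge0 //; apply: le_trans (bd 0%N); by rewrite mul0r.
Qed.

End Scheme.
End LowerBound.

Local Close Scope classical_set_scope.

(** * The lower bound *)

Lemma coprimep_no_common_root (F : closedFieldType) (a b : {poly F}) :
  (forall z, root a z -> ~~ root b z) -> coprimep a b.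
Proof.
move=> h; rewrite coprimep_def; apply/negPn/negP => /closed_rootP[z].
by rewrite root_gcd => /andP[/h/negP az /az].
Qed.

Lemma horner_mx_intertwine (K : comNzRingType) n (T B L : 'M[K]_n.+1) q :
  T *m L = L *m B -> horner_mx T q *m L = L *m horner_mx B q.
Proof.
move=> TL; elim/poly_ind: q => [|q c IH]; first by rewrite !rmorph0 mul0mx mulmx0.
rewrite !rmorphD !rmorphM /= !horner_mx_X !horner_mx_C mulmxDl mulmxDr.
rewrite -mulmxE -mulmxA TL !mulmxA IH; congr (_ + _).
by rewrite scalar_mxC.
Qed.

Lemma horner_mx_left_eigen (F : fieldType) n (M : 'M[F]_n.+1) (y : 'rV_n.+1) l q :
  y *m M = l *: y -> y *m horner_mx M q = q.[l] *: y.
Proof.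
move=> yM; elim/poly_ind: q => [|q c IH]; first by rewrite rmorph0 mulmx0 horner0 scale0r.
rewrite rmorphD rmorphM /= horner_mx_X horner_mx_C mulmxDr -mulmxE mulmxA IH -scalemxAl yM.
by rewrite scalerA mul_mx_scalar hornerMXaddC scalerDl.
Qed.

Lemma horner_mx_coprime_char (F : fieldType) n (M : 'M[F]_n.+1) q :
  coprimep q (char_poly M) -> horner_mx M q \in unitmx.
Proof.
case/Bezout_eq1_coprimepP => -[u v] /= uv.
have : horner_mx M (u * q + v * char_poly M) = 1%:M.
  by apply: etrans (congr1 (horner_mx M) uv) _; rewrite rmorph1.
rewrite rmorphD !rmorphM /= Cayley_Hamilton mulr0 addr0 => /mulmx1_unit[].
by [].
Qed.

Lemma size_prod_exp (F : fieldType) (fs : seq {poly F}) (k : {poly F} -> nat) :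
  (forall f, f \in fs -> f != 0) ->
  (size (\prod_(f <- fs) f ^+ k f)).-1 = (\sum_(f <- fs) k f * (size f).-1)%N.
Proof.
elim: fs => [|f fs IH] h; first by rewrite !big_nil size_poly1.
have f0 := h f (mem_head _ _).
have h' g : g \in fs -> g != 0 by move=> gfs; apply: h; rewrite inE gfs orbT.
have P0 : \prod_(f <- fs) f ^+ k f != 0.
  by rewrite prodf_seq_neq0; apply/allP => g /h' g0; rewrite expf_neq0.
rewrite !big_cons size_mul ?expf_neq0 // -IH //.
have := size_poly_gt0 (f ^+ k f); rewrite expf_neq0 // => fk.
have := size_poly_gt0 (\prod_(f <- fs) f ^+ k f); rewrite P0 => P1.
have := size_exp f (k f); rewrite [((size f).-1 * _)%N]mulnC => <-.
by move: (size _) (size _) fk P1 => a b /=; lia.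
Qed.

Section Lower.
Variable R : realType.
Local Notation C := R[i].
Local Notation cmx := (map_mx (real_complex R)).
Local Notation rC := (ratr : rat -> C).
Local Notation rR := (ratr : rat -> R).

Lemma mA_gt0 n (A : 'M[R]_n) z : (0 < mA A z)%N = eigenC A z.
Proof.
rewrite /mA /eigenC eigenvalue_root_char -XsubC_dvd ?dvdp_XsubCl //.
exact: monic_neq0 (char_poly_monic _).
Qed.

(** If no root of f were an eigenvalue, f(A) would be invertible and p / f would already annihilate
    A. *)
Lemma factor_eigenvalue n (A : 'M[R]_n.+1) p fs f :
  is_minpolyQ A p -> is_factorization p fs -> f \in fs ->
  exists2 z : C, root (map_poly rC f) z & eigenC A z.
Proof.
move=> [pm pA pmin] [ufs mfs ifs pE] ffs.
have fm : f \is monic := allP mfs f ffs.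
have f1 := (ifs f ffs).1.
apply: contrapT => hz; pose g := \prod_(h <- rem f fs) h.
have gm : g \is monic.
  by rewrite /g big_seq; apply: monic_prod => h /mem_rem /(allP mfs).
have pfg : p = f * g by rewrite -pE (big_rem f ffs).
have uf : horner_mx (Cmx A) (map_poly rC f) \in unitmx.
  apply/horner_mx_coprime_char/coprimep_no_common_root => z fz.
  by apply/negP => Az; apply: hz; exists z; rewrite // /eigenC eigenvalue_root_char.
have gA : horner_mx A (map_poly rR g) = 0.
  apply: (map_mx_inj (f := real_complex R)); rewrite map_mx0.
  have := congr1 (map_mx (real_complex R)) pA.
  rewrite !map_horner_mx map_mx0 !map_poly_ratr_complex pfg rmorphM rmorphM /= -mulmxE.
  by move/(congr1 (mulmx (invmx (horner_mx (Cmx A) (map_poly rC f))))); rewrite mulKmx // mulmx0.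
have := pmin g gm gA; rewrite pfg size_Mmonic ?monic_neq0 //.
have := size_poly_gt0 g; rewrite monic_neq0 //.
by move: (size f) (size g) f1 => a b /=; lia.
Qed.

Section Model.
Variables (n m : nat) (A : 'M[R]_n.+1) (T : 'M[R]_m.+1) (L : 'M[R]_(n.+1 + m.+1)).
Variable B : 'M[int]_(n.+1 + m.+1).
Hypotheses (uL : L \in unitmx) (TL : block_mx A 0 0 T *m L = L *m map_mx intr B).
Hypothesis perp_inj : forall x y, lattice L x -> lattice L y -> pperp x = pperp y -> x = y.
Let BQ : 'M[rat]_(n.+1 + m.+1) := map_mx intr B.
Let BR : 'M[R]_(n.+1 + m.+1) := map_mx intr B.
Let chi := char_poly BQ.

Let chiE : map_poly rC chi = char_poly (Cmx A) * char_poly (cmx T).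
Proof.
have e : char_poly BR = char_poly A * char_poly T.
  by rewrite -char_poly_block; apply: (char_poly_similar uL); rewrite TL.
rewrite /chi map_char_poly map_ratr_intr -(cmx_intr R) -map_char_poly e rmorphM /=.
by rewrite !map_char_poly.
Qed.

Lemma model_multiplicity f (z0 : C) : irreducible_poly f -> root (map_poly rC f) z0 -> eigenC A z0 ->
  exists k, f ^+ k %| chi /\ (s_of A f <= k * (size f).-1)%N.
Proof.
move=> fi fz0 Az0.
have chi0 : chi != 0 by exact: monic_neq0 (char_poly_monic _).
have [k [kdvd hk]] := irredp_mup (ratr : {rmorphism rat -> C}) fi chi0.
exists k; split => //.
have cA0 : char_poly (Cmx A) != 0 by exact: monic_neq0 (char_poly_monic _).
have cT0 : char_poly (cmx T) != 0 by exact: monic_neq0 (char_poly_monic _).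
have kE z : root (map_poly rC f) z -> k = (mA A z + mup z (char_poly (cmx T)))%N.
  by move=> fz; rewrite -(hk z fz) chiE mupM.
have Mk : (Mmax A f <= k)%N by apply: Mmax_le => l /kE ->; exact: leq_addr.
rewrite /s_of; case: ifP => [/andP[_ noM]|_]; last by rewrite leq_mul2r Mk orbT.
rewrite leq_mul2r; apply/orP; right; rewrite ltn_neqAle Mk andbT.
apply/eqP => kM.
(* The roots of f have total multiplicity M_f, all of it already in char A, so none is a root of
   char T. *)
have cop : coprimep (map_poly rC f) (char_poly (cmx T)).
  apply: coprimep_no_common_root => z fz.
  have mT : mup z (char_poly (cmx T)) = 0%N.
    have := kE z fz; have := Mmin_le A fz; have := Mmax_ge A fz; rewrite -leqNgt in noM.
    move: noM; rewrite kM; move: (mA A z) (mup _ _) (Mmin A f) => a b c; lia.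
  by rewrite -dvdp_XsubCl XsubC_dvd // mT.
have uT : horner_mx T (map_poly rR f) \in unitmx.
  rewrite -(map_unitmx (real_complex R)) map_horner_mx map_poly_ratr_complex.
  exact: horner_mx_coprime_char.
have nB : @horner_mx _ (n + m.+1) BQ f \notin unitmx.
  apply/negP; rewrite -(map_unitmx (ratr : {rmorphism rat -> C})) map_horner_mx => uB.
  have : root (char_poly (map_mx rC BQ)) z0.
    by rewrite -map_char_poly -/chi chiE rootM; move: Az0; rewrite /eigenC eigenvalue_root_char => ->.
  rewrite -eigenvalue_root_char => /eigenvalueP[y yB y0].
  have := horner_mx_left_eigen (map_poly rC f) yB; rewrite (rootP fz0) scale0r.
  move/(congr1 (mulmx^~ (invmx (@horner_mx _ (n + m.+1) (map_mx rC BQ) (map_poly rC f))))).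
  by rewrite mulmxK // mul0mx => y00; rewrite y00 eqxx in y0.
(* f(B) is singular over the rationals, so its kernel contains a rational vector, made integral by
   clearing denominators. *)
have [r r0 Br] : exists2 r : 'cV[rat]_(n.+1 + m.+1), r != 0 & @horner_mx _ (n + m.+1) BQ f *m r = 0.
  have : kermx (@horner_mx _ (n + m.+1) BQ f)^T != 0.
    by rewrite kermx_eq0 row_free_unit unitmx_tr.
  case/rowV0Pn => v /sub_kermxP vB v0; exists v^T.
    by apply: contra_neq v0 => e; rewrite -[v]trmxK e trmx0.
  by apply: trmx_inj; rewrite trmx_mul trmxK vB trmx0.
have [N [Z [N0 NZ]]] : exists N (Z : 'cV[int]_(n.+1 + m.+1)), (0 < N)%N /\ N%:R *: r = map_mx intr Z.
  apply: int_simultaneous_multiple => j; rewrite ord1 {j}.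
  pose D := (\prod_i absz (denq (r i ord0)))%N.
  exists D, (\col_i (numq (r i ord0) * (\prod_(l | l != i) absz (denq (r l ord0)))%N%:Z)); split.
    by apply: prodn_gt0 => i; rewrite absz_gt0 denq_neq0.
  move=> i; rewrite mxE rmorphM /= numqE /D (bigD1 i) //= natrM -mulrA [RHS]mulrAC.
  have -> : (denq (r i ord0))%:~R = (absz (denq (r i ord0)))%:R :> rat.
    by rewrite -[in LHS]absz_denq.
  by rewrite mulrC; congr (_ * _); rewrite mulrC.
have Z0 : Z != 0.
  apply: contra_neq r0 => Z0; move: NZ; rewrite Z0 map_mx0 => /eqP.
  by rewrite scaler_eq0 pnatr_eq0 -leqn0 leqNgt N0 => /eqP.
have BZ : @horner_mx _ (n + m.+1) BR (map_poly rR f) *m map_mx intr Z = 0.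
  rewrite /BR -(map_ratr_intr R B) -(map_ratr_intr R Z) -NZ -map_horner_mx -map_mxM.
  by rewrite -scalemxAr Br scaler0 map_mx0.
have := congr1 (mulmx L) BZ; rewrite mulmx0 mulmxA.
rewrite -(@horner_mx_intertwine _ (n + m.+1) (block_mx A 0 0 T) BR L) //.
rewrite -mulmxA horner_mx_block -[L *m _](vsubmxK) => e.
have {e} e : col_mx (horner_mx A (map_poly rR f) *m usubmx (L *m map_mx intr Z))
    (horner_mx T (map_poly rR f) *m dsubmx (L *m map_mx intr Z)) = 0.
  rewrite -[RHS]e.
  have := @mul_block_col _ n.+1 m.+1 n.+1 m.+1 1 (horner_mx A (map_poly rR f)) 0 0 (horner_mx T (map_poly rR f)).
  by move=> ->; rewrite !mul0mx addr0 add0r.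
move/(congr1 dsubmx): e; rewrite col_mxKd linear0 => /(congr1 (mulmx (invmx (horner_mx T (map_poly rR f))))).
rewrite mulKmx // mulmx0 => LZ.
have : L *m map_mx intr Z = L *m map_mx intr (0 : 'cV[int]_(n.+1 + m.+1)).
  apply: perp_inj; [by exists Z | by exists 0 |].
  by rewrite /pperp LZ map_mx0 mulmx0 linear0.
move/(can_inj (mulKmx uL))/matrixP => e; case/negP: Z0; apply/eqP/matrixP => i j.
by move: (e i j); rewrite !mxE => /intr_inj.
Qed.
End Model.

(** The powers f^k are pairwise coprime divisors of char B, so their degrees add up to at most the
    dimension of the lattice. *)
Lemma cps_dimension_ge n (A : 'M[R]_n.+1) p fs s :
  is_minpolyQ A p -> is_factorization p fs -> admits_cps A s ->
  (\sum_(f <- fs) s_of A f <= s)%N.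
Proof.
move=> hp hfs [m [m0 -> [L [gL [Om [wOm AOm]]]]]].
have [B [T TL]] := cps_integral_model gL wOm AOm.
case: m m0 L gL Om wOm AOm B T TL => // m _ L [uL _ injL _] Om _ _ B T TL.
have [ufs mfs ifs pE] := hfs.
have chim : char_poly (map_mx intr B : 'M[rat]_(n.+1 + m.+1)) \is monic by exact: char_poly_monic.
have h f : exists k, f \in fs -> f ^+ k %| char_poly (map_mx intr B : 'M[rat]_(n.+1 + m.+1)) /\
   (s_of A f <= k * (size f).-1)%N.
  have [ffs|_] := boolP (f \in fs); last by exists 0%N.
  have [z fz Az] := factor_eigenvalue hp hfs ffs.
  by have [k hk] := model_multiplicity uL TL injL (ifs f ffs) fz Az; exists k.
have [k hk] := choice h.
apply: (@leq_trans (\sum_(f <- fs) k f * (size f).-1)%N).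
  by rewrite big_seq [leqRHS]big_seq; apply: leq_sum => f /hk[].
rewrite -size_prod_exp => [|f /ifs]; last exact: irredp_neq0.
have -> : (n.+1 + m.+1)%N = (size (char_poly (map_mx intr B : 'M[rat]_(n.+1 + m.+1)))).-1.
  by rewrite size_char_poly.
have dv : \prod_(f <- fs) f ^+ k f %| char_poly (map_mx intr B : 'M[rat]_(n.+1 + m.+1)).
  apply: prod_dvdp_coprime => // [f g ffs gfs fg|f /hk[] //].
  apply: coprimep_expl; apply: coprimep_expr.
  apply: irredp_coprime_neq; [exact: (allP mfs)|exact: (allP mfs)|exact: ifs|exact: ifs|exact: fg].
by have := dvdp_leq (monic_neq0 chim) dv; move: (size _) (size _) => a b; lia.
Qed.

End Lower.

(** * The window and the complementary block *)

Local Open Scope classical_set_scope.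
Local Open Scope ring_scope.

Lemma open_closure_interior (X : topologicalType) (D : set X) : open D -> closure D° = closure D.
Proof. by move=> /interior_id ->. Qed.

Lemma root_prod_seq (F : fieldType) (I : eqType) (r : seq I) (E : I -> {poly F}) z :
  root (\prod_(i <- r) E i) z -> exists2 i, i \in r & root (E i) z.
Proof.
elim: r => [|i r IH]; first by rewrite big_nil (negPf (root1 z)).
rewrite big_cons rootM => /orP[iz|/IH[j jr jz]]; first by exists i; rewrite ?mem_head.
by exists j; rewrite // inE jr orbT.
Qed.

Section Window.
Variables (R : realType) (m : nat).

Definition unit_ball : set 'cV[R]_m := [set v | \sum_i v i 0 ^+ 2 < 1].

Lemma unit_ball_window : window unit_ball.
Proof.
have entry (v : 'cV[R]_m) i : unit_ball v -> `|v i 0| <= 1.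
  rewrite /unit_ball /= => lt1; rewrite -(expr_le1 (n := 2)) // -normrX ger0_norm ?sqr_ge0 //.
  apply: le_trans (ltW lt1); rewrite (bigD1 i) //= lerDl.
  by apply: sumr_ge0 => j _; exact: sqr_ge0.
split.
- exists 1; split; first exact: num_real.
  move=> b b1 v Dv /=; have -> : `|v| = mx_norm v by [].
  rewrite mx_normrE; apply/bigmax_leP; split; first exact: le_trans (ltW b1).
  by move=> [i j] _ /=; rewrite ord1; apply: le_trans (entry v i Dv) (ltW b1).
- apply: open_closure_interior.
  pose f (v : 'cV[R]_m) := \sum_i v i 0 ^+ 2.
  have cf : continuous f.
    apply: (continuous_big add_continuous) => i _ v.
    by apply: (@continuous_comp _ _ _ (fun v : 'cV[R]_m => v i 0) (fun x => x ^+ 2));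
      [exact: coord_continuous|exact: exprn_continuous].
  have -> : unit_ball = f @^-1` [set x | x < 1] by [].
  by apply: open_comp; [move=> v _; exact: cf|exact: open_lt].
- exists 0; apply: subset_closure; rewrite /unit_ball /=.
  by rewrite big1 ?ltr01 // => i _; rewrite mxE expr0n.
Qed.

End Window.

(** * The contraction and the integer matrix *)

Section Existence.
Variable R : realType.
Local Notation C := R[i].
Local Notation cmx := (map_mx (real_complex R)).
Local Notation rC := (ratr : rat -> C).
Local Notation rR := (ratr : rat -> R).

Lemma exists_left_eigen n (M : 'M[C]_n) l : root (char_poly M) l ->
  exists y : 'rV[C]_n, y != 0 /\ y *m M = l *: y.
Proof. by rewrite -eigenvalue_root_char => /eigenvalueP[y yM y0]; exists y. Qed.

Lemma exists_right_eigen n (M : 'M[C]_n) l : root (char_poly M) l ->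
  exists x : 'cV[C]_n, x != 0 /\ M *m x = l *: x.
Proof.
have -> : char_poly M = char_poly M^T.
  rewrite /char_poly -det_tr; congr (\det _).
  by rewrite /char_poly_mx linearB /= tr_scalar_mx map_trmx.
move=> /exists_left_eigen[y [y0 yM]]; exists y^T; split.
  by apply: contra_neq y0 => e; rewrite -[y]trmxK e trmx0.
by apply: trmx_inj; rewrite trmx_mul trmxK yM linearZ /= trmxK.
Qed.

Section Fixed.
Variables (n : nat) (A : 'M[R]_n.+1) (p : {poly rat}) (fs : seq {poly rat}).
Hypotheses (uA : A \in unitmx) (P1A : P1 A) (P2A : P2 A).
Hypotheses (pA : is_minpolyQ A p) (fsp : is_factorization p fs).
Implicit Type f : {poly rat}.

Let fsU : uniq fs. Proof. by case: fsp. Qed.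
Let fsM : all (fun f => f \is monic) fs. Proof. by case: fsp. Qed.
Let fsI f : f \in fs -> irreducible_poly f. Proof. by case: fsp => _ _ h _; apply: h. Qed.
Let pE : \prod_(f <- fs) f = p. Proof. by case: fsp. Qed.
Let fsm f : f \in fs -> f \is monic. Proof. exact: (allP fsM). Qed.
Let fs_eigen f : f \in fs -> exists2 z : C, root (map_poly rC f) z & eigenC A z.
Proof. exact: factor_eigenvalue pA fsp. Qed.

(** The exponent q_f = s_f / deg f. *)
Definition block_count f : nat :=
  if `[< is_cyclotomic f >] && ~~ (Mmin A f < Mmax A f)%N then (Mmax A f).+1 else Mmax A f.

Lemma s_of_block_count f : s_of A f = (block_count f * (size f).-1)%N.
Proof. by rewrite /s_of /block_count; case: ifP. Qed.

Lemma Mmax_le_block_count f : (Mmax A f <= block_count f)%N.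
Proof. by rewrite /block_count; case: ifP. Qed.

Lemma mA_le_block_count f (z : C) : root (map_poly rC f) z -> (mA A z <= block_count f)%N.
Proof. by move=> fz; apply: leq_trans (Mmax_ge A fz) (Mmax_le_block_count f). Qed.

Lemma big_root_strict f (mu : C) : f \in fs -> root (map_poly rC f) mu -> 1 < `|mu| ->
  mA A mu = Mmax A f /\ (Mmin A f < Mmax A f)%N.
Proof.
move=> ffs fmu mu1; have [z fz Az] := fs_eigen ffs.
have fi := fsI ffs.
have [|_ le [nu [[q [qi [qmu qnu]]] lt]]] := P2A mu1.
  by exists z; split => //; exists f.
have e : mA A mu = Mmax A f.
  apply/eqP; rewrite eqn_leq Mmax_ge //=.
  by apply: Mmax_le => l fl; apply: le; exists f.
split => //; rewrite -e; apply: leq_ltn_trans lt; apply: Mmin_le.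
(* The irreducible q witnessing conjugacy shares the root mu with f, hence divides it, so nu is a
   root of f. *)
have /dvdpP[u ->] : q %| f by apply: (irredp_dvd_of_root qi qmu fmu).
by rewrite rmorphM rootM qnu orbT.
Qed.

Lemma big_root_count f (mu : C) : f \in fs -> root (map_poly rC f) mu -> 1 < `|mu| ->
  mA A mu = block_count f.
Proof.
move=> ffs fmu mu1; have [-> lt] := big_root_strict ffs fmu mu1.
by rewrite /block_count lt andbF.
Qed.

Lemma factor_int f : f \in fs -> exists2 g : {poly int}, g \is monic & f = map_poly intr g.
Proof.
move=> ffs; have [z fz Az] := fs_eigen ffs.
have [q [qm qz]] := P1A Az.
exact: (monic_irredp_int (fsm ffs) (fsI ffs) fz qm qz).
Qed.

Lemma factor_root0 f : f \in fs -> ~~ root f 0.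
Proof.
move=> ffs; apply/negP => f0; have [z fz Az] := fs_eigen ffs.
have fX : f %| 'X.
  apply: (@irredp_dvd_of_root _ _ (ratr : {rmorphism rat -> C}) f 'X 0 (fsI ffs)).
    by rewrite -(rmorph0 (ratr : {rmorphism rat -> C})) fmorph_root.
  by rewrite map_polyX rootX.
have z0 : z = 0.
  have /dvdpP[u uE] := fX.
  have : root (map_poly rC 'X) z by rewrite uE rmorphM rootM fz orbT.
  by rewrite map_polyX rootX => /eqP.
case/eigenvalueP: Az => y; rewrite z0 scale0r => yA y0.
have uC : Cmx A \in unitmx by rewrite map_unitmx.
by case/negP: y0; apply/eqP; rewrite -[y](mulmxK uC) yA mul0mx.
Qed.

(** If the multiplicities differ, a root of minimal multiplicity works. If not, (P2) leaves no root
    outside the closed unit disc, f is cyclotomic by Kronecker's theorem, and q_f = M_f + 1. *)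
Lemma deficient_root f : f \in fs ->
  exists2 mu : C, root (map_poly rC f) mu & (mA A mu < block_count f)%N.
Proof.
move=> ffs; have [lt|ge] := boolP (Mmin A f < Mmax A f)%N.
  apply: contrapT => h.
  suff : (Mmax A f <= Mmin A f)%N by rewrite leqNgt lt.
  apply: Mmin_ge; first exact: Mmax_bound.
  move=> l fl; rewrite leqNgt; apply/negP => ltl; apply: h; exists l => //.
  by apply: leq_trans ltl (Mmax_le_block_count f).
have cyc : is_cyclotomic f.
  have [g gm fg] := factor_int ffs.
  apply: (@Kronecker_cyclotomic R f g) => //.
  - exact: fsm.
  - exact: fsI.
  - exact: factor_root0.
  move=> z fz; rewrite real_leNgt ?normr_real ?real1 //.
  by apply/negP => z1; have [_] := big_root_strict ffs fz z1; rewrite (negPf ge).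
have [z fz _] := fs_eigen ffs; exists z => //.
by rewrite /block_count asboolT // ge /= ltnS Mmax_ge.
Qed.

Let chi := \prod_(f <- fs) f ^+ block_count f.
Let chiC := map_poly rC chi.
Let chiR := map_poly rR chi.

Let chi_monic : chi \is monic.
Proof. by rewrite /chi big_seq; apply: monic_prod => f ffs; apply: monic_exp; exact: fsm. Qed.

Let mup_chi f (z : C) : f \in fs -> root (map_poly rC f) z -> mup z chiC = block_count f.
Proof.
move=> ffs fz.
have nz g : g \in fs -> map_poly rC g != 0.
  by move=> gfs; rewrite map_poly_eq0 irredp_neq0 //; exact: fsI.
rewrite /chiC /chi rmorph_prod mup_prod; last first.
  by move=> g gfs; rewrite /= rmorphXn expf_neq0 //; exact: nz.
rewrite (big_rem f ffs) /= rmorphXn mup_exp ?nz // mup_separable ?fz ?muln1; last first.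
  by rewrite separable_map irredp_separable //; exact: fsI.
rewrite big_seq big1 ?addn0 // => g; rewrite mem_rem_uniq // => /andP[gf gfs].
rewrite rmorphXn mup_exp ?nz // mupNroot ?muln0 //.
have cop : coprimep f g.
  apply: irredp_coprime_neq; [exact: fsm|exact: fsm|exact: fsI|exact: fsI|].
  by rewrite eq_sym.
by apply: (coprimep_root _ fz); rewrite coprimep_map.
Qed.

Let root_factor (z : C) : root (map_poly rC p) z -> exists2 f, f \in fs & root (map_poly rC f) z.
Proof.
by rewrite -pE rmorph_prod => /root_prod_seq.
Qed.

Let eigen_root (z : C) : eigenC A z -> root (map_poly rC p) z.
Proof.
case/eigenvalueP => y yA y0; have := horner_mx_left_eigen (map_poly rC p) yA.
have -> : horner_mx (Cmx A) (map_poly rC p) = 0.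
  by case: pA => _ h _; rewrite -map_poly_ratr_complex -map_horner_mx h map_mx0.
by rewrite mulmx0 => /esym/eqP; rewrite scaler_eq0 (negPf y0) orbF.
Qed.

Let char_dvd : char_poly A %| chiR.
Proof.
rewrite -(dvdp_map (real_complex R)) /chiR map_poly_ratr_complex map_char_poly.
apply: mup_dvdp.
- exact: monic_neq0 (char_poly_monic _).
- by rewrite map_poly_eq0 monic_neq0.
move=> z; rewrite -/(mA A z); have [->|/=] := posnP (mA A z); first by [].
rewrite mA_gt0 => /eigen_root/root_factor[f ffs fz].
by rewrite -/chiC (mup_chi ffs fz) mA_le_block_count.
Qed.

(** The quotient q of prod f^q_f by char A has multiplicity q_f - m_A(z) at a root z of f. This is 0
    when |z| > 1, and positive at the deficient root of each f. *)
Lemma exists_complement : exists m (A' : 'M[R]_m.+1), [/\ char_poly A * char_poly A' = chiR,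
  horner_mx A' (map_poly rR p) = 0, contracting A' &
  forall f, f \in fs -> exists2 mu : C, root (map_poly rC f) mu & root (char_poly (cmx A')) mu].
Proof.
have /dvdpP[q qE] := char_dvd.
have cm : char_poly A \is monic by exact: char_poly_monic.
have chim : chiR \is monic by rewrite map_monic.
have qm : q \is monic by move: chim; rewrite qE monicMr.
have qC0 : map_poly (real_complex R) q != 0 by rewrite map_poly_eq0 monic_neq0.
have cA0 : char_poly (Cmx A) != 0 by exact: monic_neq0 (char_poly_monic _).
have qEC : chiC = map_poly (real_complex R) q * char_poly (Cmx A).
  have -> : char_poly (Cmx A) = map_poly (real_complex R) (char_poly A) by rewrite map_char_poly.
  by rewrite -rmorphM /= -qE /chiR map_poly_ratr_complex.
have mq z : mup z chiC = (mup z (map_poly (real_complex R) q) + mA A z)%N.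
  by rewrite qEC mupM.
have qroot f : f \in fs -> exists2 mu : C, root (map_poly rC f) mu & root (map_poly (real_complex R) q) mu.
  move=> ffs; have [mu fmu lt] := deficient_root ffs; exists mu => //.
  rewrite -dvdp_XsubCl XsubC_dvd //; move: lt; rewrite -(mup_chi ffs fmu) mq.
  by move: (mup _ _) (mA A mu) => a b; clear; lia.
(* An empty factorization would give p = 1, which does not annihilate A. *)
have [f0 f0fs] : exists f, f \in fs.
  case: (fs) pE => [|f r _]; last by exists f; rewrite mem_head.
  rewrite big_nil => p1; case: pA => _ + _; rewrite -p1 !rmorph1 => /eqP.
  by rewrite oner_eq0.
have q1 : (1 < size q)%N.
  have [mu _ qmu] := qroot f0 f0fs.
  have : size (map_poly (real_complex R) q) != 1%N by apply/closed_rootP; exists mu.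
  have := size_poly_gt0 q; rewrite monic_neq0 // size_map_poly.
  by move: (size q) => a; clear; lia.
have [|m [A' [A'q A'p cA']]] := @exists_contraction R (map_poly rR p) q qm q1.
  move=> z qz.
  have zq : (0 < mup z (map_poly (real_complex R) q))%N by rewrite -XsubC_dvd // dvdp_XsubCl.
  have chiz : root chiC z by rewrite qEC rootM qz.
  have [f ffs fz] : exists2 f, f \in fs & root (map_poly rC f) z.
    move: chiz; rewrite /chiC /chi rmorph_prod => /root_prod_seq[f ffs].
    by rewrite /= rmorphXn rootE horner_exp expf_eq0 => /andP[_ fz]; exists f.
  split; last by rewrite map_poly_ratr_complex -pE (big_rem f ffs) rmorphM rootM fz.
  rewrite real_leNgt ?normr_real ?real1 //.
  apply/negP => z1; move: zq; have := mq z.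
  rewrite (mup_chi ffs fz) -(big_root_count ffs fz z1).
  by move: (mup _ _) (mA A z) => a b; clear; lia.
exists m, A'; split => //.
  by rewrite A'q qE mulrC.
move=> f ffs; have [mu fmu qmu] := qroot f ffs; exists mu => //.
by rewrite -map_char_poly A'q.
Qed.

(** q_f companion blocks for each f, built from its integral form; p kills every block since it is a
    multiple of each f. *)
Lemma exists_int_model : exists N (B : 'M[int]_N.+1),
  char_poly (map_mx intr B : 'M[rat]_N.+1) = chi /\ horner_mx (map_mx intr B : 'M[rat]_N.+1) p = 0.
Proof.
have hG f : exists g : {poly int}, f \in fs -> g \is monic /\ f = map_poly intr g.
  have [ffs|_] := boolP (f \in fs); last by exists 0.
  by have [g gm fg] := factor_int ffs; exists g.
have [G GE] := choice hG.
pose gs := flatten [seq nseq (block_count f) (G f) | f <- fs].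
have gsE g : g \in gs -> exists2 f, f \in fs & g = G f.
  by move=> /flatten_mapP[f ffs]; rewrite mem_nseq => /andP[_ /eqP ->]; exists f.
have [||N [B [BE Bq]]] := @exists_matrix_prod int gs.
- move=> g /gsE[f ffs ->]; have [gm fg] := GE f ffs; split => //.
  have := (fsI ffs).1; rewrite {1}fg size_map_inj_poly //; exact: intr_inj.
- have [f0 f0fs] : exists f, f \in fs.
    case: (fs) pE => [|f r _]; last by exists f; rewrite mem_head.
    rewrite big_nil => p1; case: pA => _ + _; rewrite -p1 !rmorph1 => /eqP.
    by rewrite oner_eq0.
  have [mu _ lt] := deficient_root f0fs.
  have : G f0 \in gs.
    by apply/flatten_mapP; exists f0; rewrite // mem_nseq eqxx andbT (leq_trans _ lt).
  by case: (gs).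
exists N, B; split.
  rewrite -map_char_poly BE /gs big_flatten big_map rmorph_prod /chi.
  rewrite big_seq [RHS]big_seq; apply: eq_bigr => f ffs.
  have [_ fg] := GE f ffs.
  by rewrite big_nseq iter_mulr_1 rmorphXn /= -fg.
have -> : p = map_poly intr (\prod_(f <- fs) G f).
  rewrite -pE rmorph_prod big_seq [RHS]big_seq; apply: eq_bigr => f ffs.
  by have [] := GE f ffs.
rewrite -map_horner_mx Bq ?map_mx0 // => g /gsE[f ffs ->].
by rewrite (big_rem f ffs) /=; exists (\prod_(y <- rem f fs) G y); rewrite mulrC.
Qed.

End Fixed.
End Existence.

Local Close Scope classical_set_scope.

(** * The generic scheme *)

Local Open Scope classical_set_scope.
Local Open Scope ring_scope.

Lemma row_mxr0_neq0 (F : nmodType) a b (y : 'rV[F]_a) : y != 0 -> row_mx y (0 : 'rV_b) != 0.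
Proof. by rewrite row_mx_eq0 negb_and => ->. Qed.

Lemma row_mxl0_neq0 (F : nmodType) a b (y : 'rV[F]_b) : y != 0 -> row_mx (0 : 'rV_a) y != 0.
Proof. by rewrite row_mx_eq0 negb_and orbC => ->. Qed.

Lemma col_mxr0_neq0 (F : nmodType) a b (x : 'cV[F]_a) : x != 0 -> col_mx x (0 : 'cV_b) != 0.
Proof. by rewrite col_mx_eq0 negb_and => ->. Qed.

Section BlockEigen.
Variables (F : fieldType) (a b : nat) (M : 'M[F]_a) (N : 'M[F]_b) (l : F).

Lemma block_left_eigen_l (y : 'rV_a) :
  y *m M = l *: y -> row_mx y 0 *m block_mx M 0 0 N = l *: row_mx y 0.
Proof. by move=> e; rewrite mul_row_block !mulmx0 !mul0mx !addr0 e scale_row_mx scaler0. Qed.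

Lemma block_left_eigen_r (y : 'rV_b) :
  y *m N = l *: y -> row_mx 0 y *m block_mx M 0 0 N = l *: row_mx 0 y.
Proof. by move=> e; rewrite mul_row_block !mulmx0 !mul0mx !add0r e scale_row_mx scaler0. Qed.

Lemma block_right_eigen_l (x : 'cV_a) :
  M *m x = l *: x -> block_mx M 0 0 N *m col_mx x 0 = l *: col_mx x 0.
Proof. by move=> e; rewrite mul_block_col !mulmx0 !mul0mx !addr0 e scale_col_mx scaler0. Qed.
End BlockEigen.

Section Final.
Variable R : realType.
Local Notation C := R[i].
Local Notation cmx := (map_mx (real_complex R)).
Local Notation rC := (ratr : rat -> C).
Local Notation rR := (ratr : rat -> R).

Section FromModel.
Variables (n m : nat) (A : 'M[R]_n.+1) (A' : 'M[R]_m.+1) (fs : seq {poly rat}).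
Variables (L : 'M[R]_(n.+1 + m.+1)) (B : 'M[int]_(n.+1 + m.+1)).
Variables (y1 : {poly rat} -> 'rV[C]_n.+1) (y2 : {poly rat} -> 'rV[C]_m.+1).
Variable x : {poly rat} -> 'cV[C]_n.+1.
Hypotheses (uL : L \in unitmx) (TL : block_mx A 0 0 A' *m L = L *m map_mx intr B).
Hypothesis L1 : forall r : 'cV[int]_(n.+1 + m.+1), r != 0 ->
  exists2 f, f \in fs & row_mx (y1 f) 0 *m cmx (L *m map_mx intr r) != 0.
Hypothesis L2 : forall r : 'cV[int]_(n.+1 + m.+1), r != 0 ->
  exists2 f, f \in fs & row_mx 0 (y2 f) *m cmx (L *m map_mx intr r) != 0.
Hypothesis L3 : forall z : 'rV[int]_(n.+1 + m.+1), z != 0 ->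
  exists2 f, f \in fs & cmx (map_mx intr z *m invmx L) *m col_mx (x f) 0 != 0.

(** A lattice vector with zero parallel or perpendicular part pairs to zero with every [y1] or [y2].
    An integral functional z = xi U has z L^-1 = (0, xi), which pairs to zero with every (x, 0), so
    z = 0 and Kronecker's criterion holds. *)
Lemma generic_cps_of_model : generic_cps L.
Proof.
have inj (k : nat) (P : 'cV[R]_(n.+1 + m.+1) -> 'cV[R]_k) :
    (forall u v, P (u - v) = P u - P v) ->
    (forall r : 'cV[int]_(n.+1 + m.+1), P (L *m map_mx intr r) = 0 -> r = 0) ->
    forall u v, lattice L u -> lattice L v -> P u = P v -> u = v.
  move=> PB hP _ _ [r1 _ <-] [r2 _ <-] e; congr (_ *m map_mx _ _).
  apply/eqP; rewrite -subr_eq0; apply/eqP/hP.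
  by rewrite map_mxB mulmxBr PB e subrr.
split => //.
- apply: inj => [u v|r]; first by rewrite /ppar linearB.
  rewrite /ppar => Lr; apply: contrapT => /eqP /L1[f _].
  by rewrite -[L *m _]vsubmxK map_col_mx mul_row_col Lr map_mx0 mulmx0 mul0mx addr0 eqxx.
- apply: inj => [u v|r]; first by rewrite /pperp linearB.
  rewrite /pperp => Lr; apply: contrapT => /eqP /L2[f _].
  by rewrite -[L *m _]vsubmxK map_col_mx mul_row_col Lr map_mx0 mulmx0 mul0mx addr0 eqxx.
have hU : no_integral_functional (dsubmx L).
  move=> xi z e.
  have zL : map_mx intr z *m invmx L = row_mx 0 xi.
    have <- : row_mx 0 xi *m L = map_mx intr z.
      by rewrite -e -[in LHS](vsubmxK L) mul_row_col mul0mx add0r.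
    by rewrite mulmxK.
  have [z0|/L3[f _]] := eqVneq z 0.
    move: zL; rewrite z0 map_mx0 mul0mx => /esym/eqP.
    by rewrite row_mx_eq0 => /andP[_ /eqP].
  by rewrite zL map_row_mx mul_row_col map_mx0 mul0mx mulmx0 addr0 eqxx.
apply: approx_dense => v e e0; have [r hr] := kronecker_density hU v e0.
exists (dsubmx L *m map_mx intr r) => //.
exists (L *m map_mx intr r); first by exists r.
by rewrite /pperp mul_dsub_mx.
Qed.

(** The lattice vector with coordinates B r has parallel part A times, and perpendicular part A'
    times, that of L r; the contraction A' keeps the latter in the ball. *)
Lemma cp_set_of_model : contracting A' ->
  forall v, cp_set L (@unit_ball R m.+1) v -> cp_set L (@unit_ball R m.+1) (A *m v).
Proof.
move=> cA' _ [_ [[r _ <-] Or] <-].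
have TLr : L *m map_mx intr (B *m r) =
    col_mx (A *m ppar (L *m map_mx intr r)) (A' *m pperp (L *m map_mx intr r)).
  rewrite map_mxM mulmxA -TL -mulmxA -[L *m map_mx intr r in LHS]vsubmxK mul_block_col.
  by rewrite !mul0mx addr0 add0r.
exists (L *m map_mx intr (B *m r)); last by rewrite TLr /ppar col_mxKu.
split; first by exists (B *m r).
rewrite TLr /pperp col_mxKd; apply: le_lt_trans (cA' _) _.
exact: Or.
Qed.
End FromModel.

Lemma admits_cps_sum n (A : 'M[R]_n.+1) p fs :
  A \in unitmx -> P1 A -> P2 A -> is_minpolyQ A p -> is_factorization p fs ->
  admits_cps A (\sum_(f <- fs) s_of A f).
Proof.
move=> uA P1A P2A pA fsp.
have [m [A' [AA' A'p cA' A'eig]]] := exists_complement uA P1A P2A pA fsp.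
have [N [B [Bchi Bp]]] := exists_int_model uA P1A P2A pA fsp.
have [ufs mfs ifs pE] := fsp.
have sN : N.+1 = (n.+1 + m.+1)%N.
  apply/eqP; rewrite -eqSS; apply/eqP.
  rewrite -[LHS](size_char_poly (map_mx intr B : 'M[rat]_N.+1)) Bchi.
  rewrite -(size_map_poly (ratr : {rmorphism rat -> R})) -AA'.
  by rewrite size_Mmonic ?monic_neq0 ?char_poly_monic // !size_char_poly addnS.
have sE : (\sum_(f <- fs) s_of A f)%N = (n.+1 + m.+1)%N.
  rewrite (eq_bigr _ (fun f _ => s_of_block_count A f)) -size_prod_exp => [|f /ifs]; last exact: irredp_neq0.
  by rewrite -Bchi size_char_poly.
have {}sN : N = (n + m.+1)%N by move: sN; clear; lia.
subst N; rewrite sE; exists m.+1; split => //.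
pose T : 'M[R]_(n.+1 + m.+1) := block_mx A 0 0 A'.
have CT : cmx T = block_mx (Cmx A) 0 0 (cmx A') by rewrite map_block_mx !map_mx0.
(* Left eigenvectors of A and of A' and right eigenvectors of A, one for each factor; outside [fs]
   the default 0 makes the choice functions total. *)
have hy1 f : exists y : 'rV[C]_n.+1, f \in fs -> y != 0 /\
    exists2 l, root (map_poly rC f) l & y *m Cmx A = l *: y.
  have [ffs|_] := boolP (f \in fs); last by exists 0.
  have [z fz] := factor_eigenvalue pA fsp ffs; rewrite /eigenC eigenvalue_root_char.
  by case/exists_left_eigen => y [y0 yA]; exists y => _; split => //; exists z.
have hy2 f : exists y : 'rV[C]_m.+1, f \in fs -> y != 0 /\
    exists2 l, root (map_poly rC f) l & y *m cmx A' = l *: y.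
  have [ffs|_] := boolP (f \in fs); last by exists 0.
  have [z fz] := A'eig f ffs.
  by case/exists_left_eigen => y [y0 yA]; exists y => _; split => //; exists z.
have hx f : exists x : 'cV[C]_n.+1, f \in fs -> x != 0 /\
    exists2 l, root (map_poly rC f) l & Cmx A *m x = l *: x.
  have [ffs|_] := boolP (f \in fs); last by exists 0.
  have [z fz] := factor_eigenvalue pA fsp ffs; rewrite /eigenC eigenvalue_root_char.
  by case/exists_right_eigen => y [y0 yA]; exists y => _; split => //; exists z.
have [y1 y1E] := choice hy1.
have [y2 y2E] := choice hy2.
have [x xE] := choice hx.
pose Y1 f : 'rV[C]_(n.+1 + m.+1) := row_mx (y1 f) 0.
pose Y2 f : 'rV[C]_(n.+1 + m.+1) := row_mx 0 (y2 f).
pose X f : 'cV[C]_(n.+1 + m.+1) := col_mx (x f) 0.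
have [||||||L [uL TL L1 L2 L3]] := @generic_intertwiner R (n + m.+1) fs T B ufs mfs ifs _ _ _
   Y1 Y2 X.
- rewrite horner_mx_block pE A'p; case: pA => _ -> _.
  exact: (@block_mx_const _ n.+1 m.+1 n.+1 m.+1 0).
- by rewrite pE.
- have -> : char_poly T = char_poly A * char_poly A' by rewrite /T char_poly_block.
  by rewrite AA' -Bchi map_char_poly map_ratr_intr.
- move=> f ffs; have [y0 [l fl yA]] := y1E f ffs; split.
    exact: (@row_mxr0_neq0 _ n.+1 m.+1).
  exists l => //; apply: etrans (congr1 (mulmx (row_mx (y1 f) 0)) CT) _.
  exact: block_left_eigen_l.
- move=> f ffs; have [y0 [l fl yA]] := y2E f ffs; split.
    exact: (@row_mxl0_neq0 _ n.+1 m.+1).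
  exists l => //; apply: etrans (congr1 (mulmx (row_mx 0 (y2 f))) CT) _.
  exact: block_left_eigen_r.
- move=> f ffs; have [x0 [l fl Ax]] := xE f ffs; split.
    exact: (@col_mxr0_neq0 _ n.+1 m.+1).
  exists l => //; apply: etrans (congr1 (mulmx^~ (col_mx (x f) 0)) CT) _.
  exact: block_right_eigen_l.
exists L; split; first exact: (generic_cps_of_model uL L1 L2 L3).
exists (@unit_ball R m.+1); split; first exact: unit_ball_window.
exact: (cp_set_of_model TL cA').
Qed.

End Final.
Local Close Scope classical_set_scope.

(* A is an (n+1) x (n+1) real matrix (the paper's dimension n >= 1). *)
Theorem theorem5 (R : realType) (n : nat) (A : 'M[R]_n.+1)
    (p : {poly rat}) (fs : seq {poly rat}) :
  A \in unitmx ->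
  diagonalizable (Cmx A) ->
  P1 A ->
  P2 A ->
  is_minpolyQ A p ->
  is_factorization p fs ->
  let s := (\sum_(f <- fs) s_of A f)%N in
  admits_cps A s /\ (forall s' : nat, admits_cps A s' -> (s <= s')%N).
Proof.
move=> uA _ P1A P2A pA fsp s; split; first exact: admits_cps_sum uA P1A P2A pA fsp.
by move=> s'; exact: cps_dimension_ge pA fsp.
Qed.
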